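(* Let $R$ be a number ring, and let $\tilde R$ denote its normalization (integral closure in its field of fractions). The following statements are equivalent: (i) every ideal of $R$ can be generated by $3$ elements; (ii) every ring $R'$ with $R\subseteq R'\subseteq \tilde R$ is super-multiplicative.
   Context: A number ring is a subring of a number field (a finite extension of $\mathbb{Q}$). For a commutative ring $A$ and an ideal $I$ of $A$ with $[A:I]$ finite, the norm is $N(I)=[A:I]$ (index as additive groups). A commutative ring $A$ is called super-multiplicative if for every pair of $A$-ideals $I,J$ such that $[A:IJ]$ is finite one has $N(IJ)\geq N(I)N(J)$. *)

(* Defs.v *)
(* A number field is modelled as L : fieldExtType rat
   (a field that is a finite-dimensional Q-algebra); subrings, ideals etc.
   are predicates L -> Prop. *)
From mathcomp Require Import all_boot all_order all_algebra all_field.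
Set Implicit Arguments. Unset Strict Implicit. Unset Printing Implicit Defensive.
Import GRing.Theory.
Local Open Scope ring_scope.

Section Defs.
Variable L : fieldExtType rat.

Definition is_subring (S : L -> Prop) : Prop :=
  [/\ S 1, (forall x y, S x -> S y -> S (x - y)) &
      (forall x y, S x -> S y -> S (x * y))].

Definition is_ideal (A I : L -> Prop) : Prop :=
  [/\ (forall x, I x -> A x), I 0,
      (forall x y, I x -> I y -> I (x - y)) &
      (forall a x, A a -> I x -> I (a * x))].

Definition ideal_mul (I J : L -> Prop) : L -> Prop :=
  fun x => exists (n : nat) (f g : nat -> L),
    (forall k, (k < n)%N -> I (f k)) /\ (forall k, (k < n)%N -> J (g k)) /\
    x = \sum_(k < n) f k * g k.

(* [A : I] = n as additive groups: s is a complete irredundant system of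
   representatives of A / I of size n *)
Definition index_is (A I : L -> Prop) (n : nat) : Prop :=
  exists s : seq L, [/\ size s = n,
    (forall i, (i < n)%N -> A (nth 0 s i)),
    (forall i j, (i < n)%N -> (j < n)%N -> I (nth 0 s i - nth 0 s j) -> i = j) &
    (forall a, A a -> exists2 i, (i < n)%N & I (a - nth 0 s i))].

Definition super_multiplicative (A : L -> Prop) : Prop :=
  forall I J, is_ideal A I -> is_ideal A J ->
  forall n, index_is A (ideal_mul I J) n ->
  exists m k, [/\ index_is A I m, index_is A J k & (m * k <= n)%N].

Definition gen_by_3 (A I : L -> Prop) : Prop :=
  exists a b c, [/\ A a, A b, A c &
    forall x, I x <-> exists r1 r2 r3,
      [/\ A r1, A r2, A r3 & x = r1 * a + r2 * b + r3 * c]].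

Definition in_frac_field (A : L -> Prop) (x : L) : Prop :=
  exists a b, [/\ A a, A b, b != 0 & x = a / b].

Definition integral_over (A : L -> Prop) (x : L) : Prop :=
  exists p : {poly L}, [/\ p \is monic, (forall i, A p`_i) & root p x].

Definition normalization (A : L -> Prop) : L -> Prop :=
  fun x => in_frac_field A x /\ integral_over A x.

End Defs.

(* Main.v *)
(* (i) => (ii).  For maximal m, the quotient IJ/mIJ has dimension at most 3, and elementary linear
   algebra (valid over every residue field) gives x in I and y in J with IJ = xJ + yI locally;
   by approximation one gets this globally with x <> 0.  Then IJ/xJ is a quotient of I/xA, whence
   N(IJ) >= N(xJ) / [I : xA] = N(I) N(J).

   (ii) => (i).  Let O be the normalization of R.  It is contained in (1/d) R, where d is a
   discriminant, and its nonzero ideals are invertible.  If some ideal I needs 4 generators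
   locally at m, then dim O/mO >= dim I/mI >= 4 over k = R/m.  Since O/mO is not of the form
   k + E with E^2 = 0 and dim E >= 3, it contains a, b with 1, a, b, ab linearly independent, and
   with M = mO = tO + M^2 the ideals t<1, a> + M^2 and t<1, b> + M^2 of the ring R + M violate
   super-multiplicativity. *)
Require Import Defs.
From Stdlib Require Import Classical ClassicalEpsilon.
From mathcomp Require Import all_boot all_order all_algebra all_field.
From mathcomp Require Import ring.
Set Implicit Arguments. Unset Strict Implicit. Unset Printing Implicit Defensive.
Import GRing.Theory.
Local Open Scope ring_scope.

(** [R] need not be finitely generated over Z, so an element integral over [R] need not be an
    algebraic integer, while a discriminant controls only the algebraic integers of Frac R.
    [conductor] bridges the gap: one prime at a time, a suitable multiple of the element is split
    into an algebraic integer and an element of [R]. Local choices come from linear algebra valid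
    over every field and are glued by the Chinese remainder theorem. The number 4 in the converse is
    the dimension of the product <1, a><1, b>. If this product had dimension 3, the indices of the
    two test ideals and of their product would satisfy super-multiplicativity with equality; one
    more dimension breaks it. *)

Lemma ex_least (P : nat -> Prop) :
  (exists n, P n) -> exists2 n, P n & forall k, P k -> (n <= k)%N.
Proof.
case=> n; elim/ltn_ind: n => n IH Pn.
case: (classic (exists2 k, P k & (k < n)%N)) => [[k Pk /IH]|H]; first exact.
exists n => // k Pk; rewrite leqNgt; apply/negP => kn; apply: H; by exists k.
Qed.

(** * Finite indices of additive subgroups *)

Section Index.
Variable L : fieldExtType rat.
Implicit Types (G H F A I : L -> Prop) (x y s : L).

Definition subp G H := forall x, G x -> H x.
Definition addgrp G := G 0 /\ forall x y, G x -> G y -> G (x - y).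

Lemma agN G x : addgrp G -> G x -> G (- x).
Proof. by case=> G0 GB Gx; rewrite -sub0r; apply: GB. Qed.

Lemma agD G x y : addgrp G -> G x -> G y -> G (x + y).
Proof. by move=> gG Gx Gy; rewrite -[y]opprK; apply: gG.2 => //; apply: agN. Qed.

Lemma agBC G x y : addgrp G -> G (x - y) -> G (y - x).
Proof. by move=> gG /(agN gG); rewrite opprB. Qed.

Lemma agB_trans G y x z : addgrp G -> G (x - y) -> G (y - z) -> G (x - z).
Proof. by move=> gG h1 h2; rewrite -(subrK y x) -addrA; apply: agD. Qed.

Lemma ag_sum G (J : Type) (r : seq J) (P : pred J) (f : J -> L) : addgrp G ->
  (forall i, P i -> G (f i)) -> G (\sum_(i <- r | P i) f i).
Proof. move=> gG Gf; apply: (big_ind G) => //; [exact: gG.1 | by move=> *; apply: agD]. Qed.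

Lemma agMn G x n : addgrp G -> G x -> G (x *+ n).
Proof.
by move=> gG Gx; elim: n => [|n IH]; [rewrite mulr0n; exact: gG.1 | rewrite mulrS; apply: agD].
Qed.

Lemma agMz G x (n : int) : addgrp G -> G x -> G (x *~ n).
Proof.
move=> gG Gx; case: n => n; first exact: agMn.
by rewrite NegzE mulrNz; apply: agN => //; apply: agMn.
Qed.

Lemma index_of_finType (T : finType) G H (f : T -> L) :
  (forall i, G (f i)) -> (forall i j, H (f i - f j) -> i = j) ->
  (forall a, G a -> exists i, H (a - f i)) -> index_is G H #|T|.
Proof.
move=> fG finj fsur; exists [seq f i | i <- enum T].
have sz : size [seq f i | i <- enum T] = #|T| by rewrite size_map -cardE.
case: (pickP [pred x : T | true]) => [x0 _|T0]; last first.
  have c0 : #|T| = 0 by apply: eq_card0 => x; have := T0 x.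
  split=> // [i|i j|a Ga]; rewrite ?c0 //.
  by have [i _] := fsur a Ga; have := T0 i.
have nthE i : (i < #|T|)%N -> nth 0 [seq f i | i <- enum T] i = f (nth x0 (enum T) i).
  by move=> iT; rewrite (nth_map x0) // -cardE.
split=> // [i iT|i j iT jT|a Ga].
- by rewrite nthE.
- rewrite !nthE // => /finj e.
  by apply/eqP; rewrite -(nth_uniq x0 _ _ (enum_uniq T)) -?cardE // e.
- have [t Ht] := fsur a Ga; exists (index t (enum T)).
    by rewrite cardE index_mem mem_enum.
  by rewrite nthE ?nth_index ?mem_enum // cardE index_mem mem_enum.
Qed.

Lemma index_reps G H n : index_is G H n ->
  exists f : 'I_n -> L, [/\ forall i, G (f i), forall i j, H (f i - f j) -> i = j &
  forall a, G a -> exists i, H (a - f i)].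
Proof.
case=> s [_ sG sinj ssur]; exists (fun i => nth 0 s i); split=> [i|i j h|a /ssur[i iP Hi]].
- exact: sG.
- by apply: val_inj; apply: sinj h.
- by exists (Ordinal iP).
Qed.

(** [f] is only asked to be well defined and surjective on cosets. Choosing a preimage for each
    coset of [H'] gives an injection back. *)
Lemma index_surj_le G H n G' H' n' (f : L -> L) : addgrp H -> addgrp H' ->
  index_is G H n -> index_is G' H' n' ->
  (forall x y, G x -> G y -> H (x - y) -> H' (f x - f y)) ->
  (forall y, G' y -> exists2 x, G x & H' (y - f x)) -> (n' <= n)%N.
Proof.
move=> gH gH' /index_reps[s [sG sinj ssur]] /index_reps[s' [sG' sinj' ssur']] fH fsur.
have /fin_all_exists[g gP] : forall j : 'I_n', exists i : 'I_n,
    exists2 x, G x & H (x - s i) /\ H' (s' j - f x).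
  move=> j; have [x Gx Hx] := fsur _ (sG' j); have [i Hi] := ssur x Gx.
  by exists i, x.
rewrite -[n']card_ord -[n]card_ord; apply: (@leq_card _ _ g) => i j eg.
have [x Gx [Hx Hfx]] := gP i; have [y Gy [Hy Hfy]] := gP j.
apply: sinj'; apply: (agB_trans gH' Hfx).
apply: (agB_trans gH' _ (agBC gH' Hfy)).
by apply: fH => //; apply: (agB_trans gH Hx); rewrite eg; apply: agBC.
Qed.

Lemma index_sub_le G H n G' n' : addgrp H -> index_is G H n -> index_is G' H n' ->
  subp G' G -> (n' <= n)%N.
Proof.
move=> gH h h' sGG'; apply: (index_surj_le (f := id) gH gH h h') => // y G'y.
by exists y; [apply: sGG' | rewrite subrr; apply: gH.1].
Qed.

Lemma index_unique G H n n' : addgrp H -> index_is G H n -> index_is G H n' -> n = n'.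
Proof.
by move=> gH h h'; apply/eqP; rewrite eqn_leq (index_sub_le gH h' h) // (index_sub_le gH h h').
Qed.

Lemma index_transfer G H n G' H' (f : L -> L) : addgrp H -> addgrp H' ->
  index_is G H n -> (forall x, G x -> G' (f x)) ->
  (forall x y, G x -> G y -> H (x - y) -> H' (f x - f y)) ->
  (forall x y, G x -> G y -> H' (f x - f y) -> H (x - y)) ->
  (forall y, G' y -> exists2 x, G x & H' (y - f x)) -> index_is G' H' n.
Proof.
move=> gH gH' /index_reps[s [sG sinj ssur]] fG fH fH' fsur.
rewrite -[n]card_ord; apply: (index_of_finType (f := f \o s)) => [i|i j /= h|a].
- exact/fG/sG.
- by apply: sinj; apply: fH'.
- move=> /fsur[x Gx Hx]; have [i Hi] := ssur x Gx; exists i => /=.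
  by apply: (agB_trans gH' Hx); apply: fH.
Qed.

Lemma index_ext G H n G' H' : addgrp H -> addgrp H' -> index_is G H n ->
  (forall x, G x <-> G' x) -> (forall x, H x <-> H' x) -> index_is G' H' n.
Proof.
move=> gH gH' h eG eH; apply: (index_transfer (f := id) gH gH' h).
- by move=> x /eG.
- by move=> x y _ _ /eH.
- by move=> x y _ _ /eH.
- by move=> y /eG Gy; exists y => //; rewrite subrr; apply: gH'.1.
Qed.

Lemma index_trans F G H a b : addgrp G -> addgrp F -> subp G F -> subp H G ->
  addgrp H -> index_is F G a -> index_is G H b -> index_is F H (a * b)%N.
Proof.
move=> gG gF sGF sHG gH /index_reps[s [sF sinj ssur]] /index_reps[r [rG rinj rsur]].
have -> : (a * b)%N = #|{: 'I_a * 'I_b}| by rewrite card_prod !card_ord.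
apply: (index_of_finType (f := fun i => s i.1 + r i.2)) => [i|[i k] [j l] /= h|x Fx].
- by apply: agD => //; apply/sGF/rG.
- have e : i = j.
    apply: sinj; have -> : s i - s j = (s i + r k - (s j + r l)) - (r k - r l).
      by rewrite opprD addrACA addrK.
    by apply: gG.2; [apply: sHG | apply: gG.2].
  move: h; rewrite e opprD addrACA subrr add0r => /rinj -> //.
- have [i Gi] := ssur x Fx; have [j Hj] := rsur _ Gi.
  by exists (i, j); rewrite /= opprD addrA.
Qed.

(** Finite index without the count. Representatives may lie outside [G] and may repeat, so the same
    list survives when [G] shrinks or [H] grows. *)
Definition fin_idx G H := exists s : seq L, forall a, G a -> exists2 x, x \in s & H (a - x).

Lemma fin_idx_sub G G' H : subp G' G -> fin_idx G H -> fin_idx G' H.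
Proof. by move=> sG [s h]; exists s => a /sG /h. Qed.

Lemma fin_idx_sup G H H' : subp H H' -> fin_idx G H -> fin_idx G H'.
Proof. by move=> sH [s h]; exists s => a /h[x xs /sH]; exists x. Qed.

Lemma fin_idx_trans F G H : fin_idx F G -> fin_idx G H -> fin_idx F H.
Proof.
move=> [s sP] [r rP]; exists [seq x + y | x <- s, y <- r] => a /sP[x xs] /rP[y yr h].
by exists (x + y); [apply: allpairs_f | rewrite opprD addrA].
Qed.

Lemma index_fin G H n : index_is G H n -> fin_idx G H.
Proof.
move=> [s [sz sG _ ssur]]; exists s => a /ssur[i iP h].
by exists (nth 0 s i) => //; rewrite mem_nth // sz.
Qed.

(** A covering family of least length is irredundant: of two congruent members one could be
    dropped. *)
Lemma fin_index G H : G 0 -> addgrp H -> fin_idx G H -> exists n, index_is G H n.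
Proof.
move=> G0 gH [s sP].
pose cov n := exists f : 'I_n -> L, (forall i, G (f i)) /\ forall a, G a -> exists i, H (a - f i).
have : exists n, cov n.
  (* Each listed element is replaced by an element of [G] in its coset, or by 0 if its coset misses
     [G]. *)
  have /fin_all_exists[g gP] : forall i : 'I_(size s), exists z, G z /\
      (forall y, G y -> H (y - s`_i) -> H (y - z)).
    move=> i; case: (classic (exists2 z, G z & H (z - s`_i))) => [[z Gz Hz]|no].
      exists z; split=> // y Gy Hy; exact: (agB_trans gH Hy (agBC gH Hz)).
    by exists 0; split=> // y Gy Hy; case: no; exists y.
  exists (size s), g; split=> [i|a Ga]; first by case: (gP i).
  have [x xs Hx] := sP a Ga; move: xs; rewrite -index_mem => xs.
  exists (Ordinal xs); apply: (gP (Ordinal xs)).2 => //=.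
  by rewrite nth_index // -index_mem.
case/ex_least=> n [f [fG fsur]] nmin; exists n.
rewrite -[n]card_ord; apply: (index_of_finType (f := f)) => // i j Hij.
apply/eqP/negP => /negP ij; case: n => [|n] in f fG fsur nmin i j Hij ij *; first by case: i ij {Hij}.
have : cov n; last by move/nmin; rewrite ltnn.
exists (fun k => f (lift i k)); split=> // a /fsur[k Hk].
case: (unliftP i k) => [l kl|ki]; first by exists l; rewrite -kl.
case: (unliftP i j) => [l jl|ji]; last by rewrite ji eqxx in ij.
by exists l; rewrite -jl; apply: (agB_trans gH _ Hij); rewrite -ki.
Qed.

Lemma index_gt0 G H n : G 0 -> index_is G H n -> (0 < n)%N.
Proof. by move=> G0 [s [_ _ _ h]]; have [i] := h 0 G0; case: n {h}. Qed.

Lemma index1_sub G H : addgrp H -> G 0 -> index_is G H 1 -> subp G H.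
Proof.
move=> gH G0 /index_reps[s [_ _ ssur]] x Gx.
have [i h] := ssur x Gx; have [j h0] := ssur 0 G0.
rewrite -[x]subr0; apply: (agB_trans gH h); apply: (agBC gH).
by rewrite (ord1 i) -(ord1 j).
Qed.

Lemma index_factor F G H n : addgrp F -> addgrp G -> addgrp H -> subp G F -> subp H G ->
  index_is F H n -> exists a b, [/\ index_is F G a, index_is G H b & n = (a * b)%N].
Proof.
move=> gF gG gH sGF sHG h; have fFH := index_fin h.
have [a ha] := fin_index gF.1 gG (fin_idx_sup sHG fFH).
have [b hb] := fin_index gG.1 gH (fin_idx_sub sGF fFH).
exists a, b; split=> //; apply: (index_unique gH h); exact: (index_trans (G := G)).
Qed.
End Index.

(** * Submodules of [L] over a subring, and their products *)

Section Modules.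
Variable L : fieldExtType rat.
Implicit Types (A G H I J M : L -> Prop) (a x y s : L).

Definition is_mod A G := addgrp G /\ forall a x, A a -> G x -> G (a * x).
Definition mulp x G : L -> Prop := fun y => exists2 g, G g & y = x * g.
(* [adj A H s] is the module [H + A s]. *)
Definition adj A H s : L -> Prop := fun x => exists2 r, A r & H (x - r * s).

Section Ring.
Variable A : L -> Prop.
Hypothesis rA : is_subring A.

Lemma ring1 : A 1. Proof. by case: rA. Qed.
Lemma ring_ag : addgrp A.
Proof. by case: rA => A1 AB _; split=> //; rewrite -(subrr 1); apply: AB. Qed.
Lemma ringM a b : A a -> A b -> A (a * b). Proof. by case: rA => _ _; apply. Qed.
Lemma ring0 : A 0. Proof. exact: ring_ag.1. Qed.
Lemma ringB a b : A a -> A b -> A (a - b). Proof. exact: ring_ag.2. Qed.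
Lemma ringD a b : A a -> A b -> A (a + b). Proof. exact: agD ring_ag. Qed.
Lemma ringN a : A a -> A (- a). Proof. exact: agN ring_ag. Qed.
Lemma ringX a n : A a -> A (a ^+ n).
Proof. by move=> Aa; elim: n => [|n IH]; [exact: ring1 | rewrite exprS; apply: ringM]. Qed.
Lemma ring_nat n : A n%:R. Proof. exact: agMn ring_ag ring1. Qed.
Lemma ring_int (n : int) : A n%:~R. Proof. exact: agMz ring_ag ring1. Qed.

Lemma mod_ring : is_mod A A. Proof. by split; [exact: ring_ag | exact: ringM]. Qed.

Lemma ideal_mod I : is_ideal A I -> is_mod A I.
Proof. by case=> _ I0 IB IM. Qed.

Lemma ideal_sub I : is_ideal A I -> subp I A. Proof. by case. Qed.

Lemma mod_ideal I : is_mod A I -> subp I A -> is_ideal A I.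
Proof. by case=> -[I0 IB] IM sIA; split. Qed.

Lemma ideal_ring : is_ideal A A. Proof. exact: mod_ideal mod_ring _. Qed.

Lemma modM I a x : is_mod A I -> A a -> I x -> I (a * x). Proof. by case=> _; apply. Qed.
Lemma modMr I a x : is_mod A I -> A a -> I x -> I (x * a).
Proof. by rewrite mulrC; apply: modM. Qed.

Lemma mod_mulp G x : is_mod A G -> is_mod A (mulp x G).
Proof.
case=> -[G0 GB] GM; split; first split.
- by exists 0; rewrite ?mulr0.
- by move=> _ _ [g Gg ->] [h Gh ->]; exists (g - h); [apply: GB | rewrite mulrBr].
- by move=> a _ Aa [g Gg ->]; exists (a * g); [apply: GM | rewrite mulrCA].
Qed.

Lemma mod_adj H s : is_mod A H -> is_mod A (adj A H s).
Proof.
case=> -[H0 HB] HM; split; first split.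
- by exists 0; [exact: ring0 | rewrite mul0r subr0].
- move=> x y [r Ar h] [r' Ar' h']; exists (r - r'); first exact: ringB.
  have -> : x - y - (r - r') * s = (x - r * s) - (y - r' * s) by ring.
  exact: HB.
- move=> a x Aa [r Ar h]; exists (a * r); first exact: ringM.
  by rewrite -mulrA -mulrBr; apply: HM.
Qed.

Lemma adjS H s : subp H (adj A H s).
Proof. by move=> x Hx; exists 0; [exact: ring0 | rewrite mul0r subr0]. Qed.

Lemma adj_gen H s : H 0 -> adj A H s s.
Proof. by move=> H0; exists 1; [exact: ring1 | rewrite mul1r subrr]. Qed.

Lemma adj_mono H H' s : subp H H' -> subp (adj A H s) (adj A H' s).
Proof. by move=> sH x [r Ar /sH]; exists r. Qed.

Lemma adj_sub H s G : is_mod A G -> subp H G -> G s -> subp (adj A H s) G.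
Proof.
move=> mG sHG Gs x [r Ar /sHG h]; rewrite -(subrK (r * s) x).
by apply: (agD mG.1) => //; apply: modM.
Qed.

End Ring.

Lemma mod_sub A B G : subp A B -> is_mod B G -> is_mod A G.
Proof. by move=> sAB [gG GM]; split=> // a x /sAB; apply: GM. Qed.

Lemma ideal_mul_ag I J : addgrp I -> addgrp (ideal_mul I J).
Proof.
move=> gI; split; first by exists 0%N, (fun=> 0), (fun=> 0); rewrite big_ord0.
move=> x y [n [f [g [fI [gJ ->]]]]] [m [f' [g' [fI' [gJ' ->]]]]].
exists (n + m)%N, (fun k => if (k < n)%N then f k else - f' (k - n)%N),
  (fun k => if (k < n)%N then g k else g' (k - n)%N); split; [|split].
- move=> k kn; case: ltnP => h; first exact: fI.
  by apply: agN => //; apply: fI'; rewrite ltn_subLR.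
- by move=> k kn; case: ltnP => h; [exact: gJ | apply: gJ'; rewrite ltn_subLR].
- rewrite big_split_ord /= -sumrN; congr (_ + _); apply: eq_bigr => i _.
    by rewrite ltn_ord.
  by rewrite ltnNge leq_addr /= addKn mulNr.
Qed.

Lemma ideal_mulI I J x y : I x -> J y -> ideal_mul I J (x * y).
Proof. by move=> Ix Jy; exists 1%N, (fun=> x), (fun=> y); rewrite big_ord1. Qed.

Lemma ideal_mul_sub I J G : addgrp G -> (forall x y, I x -> J y -> G (x * y)) ->
  subp (ideal_mul I J) G.
Proof.
move=> gG h _ [n [f [g [fI [gJ ->]]]]]; apply: ag_sum => // i _.
by apply: h; [apply: fI | apply: gJ].
Qed.

Lemma ideal_mulS I J I' J' : subp I I' -> subp J J' -> subp (ideal_mul I J) (ideal_mul I' J').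
Proof.
move=> sI sJ x [n [f [g [fI [gJ ->]]]]]; exists n, f, g.
by split=> [k /fI /sI|] //; split=> // k /gJ /sJ.
Qed.

Lemma ideal_mul_mod A I J : is_mod A I -> addgrp J -> is_mod A (ideal_mul I J).
Proof.
move=> mI gJ; split; first exact: ideal_mul_ag mI.1.
move=> a x Aa [n [f [g [fI [gJ' ->]]]]].
exists n, (fun k => a * f k), g; split=> [k /fI|]; first exact: mI.2.
by split=> //; rewrite mulr_sumr; apply: eq_bigr => i _; rewrite mulrA.
Qed.

Lemma ideal_mul_mod_r A I J : addgrp I -> is_mod A J -> is_mod A (ideal_mul I J).
Proof.
move=> gI mJ; split; first exact: ideal_mul_ag.
move=> a x Aa [n [f [g [fI [gJ ->]]]]].
exists n, f, (fun k => a * g k); split=> //; split=> [k /gJ|]; first exact: mJ.2.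
by rewrite mulr_sumr; apply: eq_bigr => i _; rewrite mulrCA.
Qed.

Lemma ideal_mul_sub_mod A I J : is_mod A J -> subp I A -> subp (ideal_mul I J) J.
Proof. by move=> mJ sI; apply: ideal_mul_sub mJ.1 _ => x y /sI Ax Jy; apply: mJ.2. Qed.

Lemma ideal_mul_sub_modl A I J : is_mod A I -> subp J A -> subp (ideal_mul I J) I.
Proof.
by move=> mI sJ; apply: ideal_mul_sub mI.1 _ => x y Ix /sJ Ay; rewrite mulrC; apply: mI.2.
Qed.

Lemma ideal_mul_ideal A I J : is_subring A -> is_ideal A I -> is_ideal A J ->
  is_ideal A (ideal_mul I J).
Proof.
move=> rA iI iJ; have mI := ideal_mod iI; have mJ := ideal_mod iJ.
apply: mod_ideal; first exact: ideal_mul_mod mJ.1.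
by move=> x /(ideal_mul_sub_mod mJ (ideal_sub iI)); apply: ideal_sub.
Qed.

Lemma mulp_ag G x : addgrp G -> addgrp (mulp x G).
Proof.
case=> G0 GB; split; first by exists 0; rewrite ?mulr0.
by move=> _ _ [g Gg ->] [h Gh ->]; exists (g - h); [apply: GB | rewrite mulrBr].
Qed.

Lemma index_mulp G H n x : x != 0 -> addgrp H -> index_is G H n ->
  index_is (mulp x G) (mulp x H) n.
Proof.
move=> x0 gH h; apply: (index_transfer (f := fun y => x * y) gH (mulp_ag x gH) h).
- by move=> y Gy; exists y.
- by move=> y z _ _ Hyz; rewrite -mulrBr; exists (y - z).
- by move=> y z _ _; rewrite -mulrBr => -[w Hw /(mulfI x0) ->].
- by move=> _ [g Gg ->]; exists g; rewrite ?subrr //; exact: (mulp_ag x gH).1.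
Qed.

Lemma fin_idx_mulp G H x : fin_idx G H -> fin_idx (mulp x G) (mulp x H).
Proof.
move=> [s h]; exists [seq x * z | z <- s] => _ [g /h[z zs Hz] ->].
by exists (x * z); [apply: map_f | exists (g - z); rewrite // mulrBr].
Qed.
End Modules.

(** * Integral relations and the finiteness of G / pG *)

Section FiniteRank.
Variable L : fieldExtType rat.
Implicit Types (A G : L -> Prop) (x z : L).

Lemma char0_int (n : int) : (n%:~R == 0 :> L) = (n == 0).
Proof.
have -> : n%:~R = (n%:~R : rat)%:A :> L by rewrite scaler_int.
by rewrite scaler_eq0 oner_eq0 orbF intr_eq0.
Qed.

Lemma char0_nat n : (n%:R == 0 :> L) = (n == 0)%N.
Proof. exact: (char0_int n). Qed.

Lemma int_dep k (v : 'I_k -> L) : (\dim {:L} < k)%N ->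
  exists c : 'I_k -> int, (exists i, c i != 0) /\ \sum_i (c i)%:~R * v i = 0.
Proof.
move=> dk; pose X := [tuple v i | i < k].
have /freeP nf : ~~ free X.
  apply/negP => /eqP fX; have := dimvS (subvf <<X>>%VS).
  by rewrite fX size_tuple leqNgt dk.
have [q [i0 qi0] qs] : exists2 q : 'I_k -> rat, (exists i, q i != 0) & \sum_i q i *: v i = 0.
  apply: NNPP => no; apply: nf => q e i; apply/eqP/negP => /negP qi; apply: no.
  exists q; first by exists i.
  by rewrite -[RHS]e; apply: eq_bigr => j _; rewrite -tnth_nth tnth_mktuple.
pose D : int := \prod_i denq (q i).
have Dd i : exists c : int, D%:~R * q i = c%:~R.
  exists (numq (q i) * \prod_(j | j != i) denq (q j)).
  by rewrite /D (bigD1 i) //=; set E := \prod_(j | _) _; rewrite !rmorphM /= numqE; ring.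
have D0 : D != 0 by apply/prodf_neq0 => i _; apply: denq_neq0.
have [c cP] := fin_all_exists Dd; exists c; split.
  exists i0; rewrite -(intr_eq0 rat) -cP mulf_neq0 ?intr_eq0 //.
have := congr1 ( *:%R (D%:~R : rat)) qs; rewrite scaler0 scaler_sumr; apply: etrans; apply: eq_bigr => i _.
by rewrite scalerA cP scaler_int mulrzl.
Qed.

(** Among all integral relations, one with least sum of absolute values is not divisible by [p]:
    dividing by [p] would shrink it. *)
Lemma int_dep_prime p k (v : 'I_k -> L) : (1 < p)%N -> (\dim {:L} < k)%N ->
  exists c : 'I_k -> int, (exists i, ~~ (p %| c i)%Z) /\ \sum_i (c i)%:~R * v i = 0.
Proof.
move=> p1 /int_dep dep.
have : exists n, exists c : 'I_k -> int,
   [/\ (exists i, c i != 0), \sum_i (c i)%:~R * v i = 0 & n = (\sum_i `|c i|)%N].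
  by have [c [c0 e]] := dep v; exists (\sum_i `|c i|)%N, c.
case/ex_least=> n [c [[i0 c0] e ->]] cmin.
case: (classic (exists i, ~~ (p %| c i)%Z)) => [h|no]; first by exists c.
have /fin_all_exists[d dP] : forall i, exists d : int, c i = d * p.
  move=> i; have : (p %| c i)%Z by apply/negP => /negP h; apply: no; exists i.
  by case/dvdzP => d ->; exists d.
have d0 : d i0 != 0 by apply: contraNneq c0 => h; rewrite dP h mul0r.
have p0 : (0 < p)%N by apply: ltn_trans p1.
have /cmin : exists c' : 'I_k -> int,
   [/\ (exists i, c' i != 0), \sum_i (c' i)%:~R * v i = 0 &
     (\sum_i `|d i|)%N = (\sum_i `|c' i|)%N].
  exists d; split=> //; first by exists i0.
  have pL : p%:R != 0 :> L by rewrite char0_nat -lt0n.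
  apply: (mulfI pL); rewrite mulr0; apply: etrans e; rewrite mulr_sumr; apply: eq_bigr => i _.
  by rewrite dP rmorphM /= mulrA [p%:R * _]mulrC.
under eq_bigr do rewrite dP abszM.
rewrite -big_distrl /= leqNgt ltn_Pmulr // lt0n sum_nat_eq0.
by apply/forallPn; exists i0; rewrite absz_eq0.
Qed.

(** G / pG is an F_p-space of dimension at most [\dim {:L}], because a relation from [int_dep_prime]
    stays nontrivial modulo [p]. Combinations of a maximal independent family with coefficients in
    [0, p) represent all classes; [G] need not be finitely generated. *)
Lemma fin_idx_prime G p : addgrp G -> prime p -> fin_idx G (mulp p%:R G).
Proof.
move=> gG pp; have gpG := mulp_ag p%:R gG; have p1 := prime_gt1 pp.
have p0 := prime_gt0 pp.
pose indep k := exists v : 'I_k -> L, (forall i, G (v i)) /\ forall c : 'I_k -> int,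
  mulp p%:R G (\sum_i (c i)%:~R * v i) -> forall i, (p %| c i)%Z.
have bnd k : indep k -> (k <= \dim {:L})%N.
  case=> v [vG h]; rewrite leqNgt; apply/negP => dk.
  have [c [[i /negP ci] e]] := int_dep_prime v p1 dk; apply: ci; apply: h.
  by rewrite e; exact: gpG.1.
have [k [v [vG vi]] kmax] : exists2 k, indep k & ~ indep k.+1.
  apply: NNPP => no.
  have : forall k, indep k.
    elim=> [|k IH]; last by apply: NNPP => h; apply: no; exists k.
    by exists (fun=> 0); split=> [|c _] [].
  by move/(_ (\dim {:L}).+1)/bnd; rewrite ltnn.
exists [seq \sum_i (c i : nat)%:R * v i | c : {ffun 'I_k -> 'I_p}] => a Ga.
have [c ci h] : exists2 c : 'I_k.+1 -> int, (exists i, ~~ (p %| c i)%Z) &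
    mulp p%:R G (\sum_i (c i)%:~R * (if unlift ord0 i is Some j then v j else a)).
  apply: NNPP => no; apply: kmax.
  exists (fun i => if unlift ord0 i is Some j then v j else a); split.
    by move=> i; case: unliftP.
  move=> c h i; apply/negP => /negP ci; apply: no; exists c => //; by exists i.
move: h; rewrite big_ord_recl unlift_none.
rewrite (eq_bigr (fun i => (c (lift ord0 i))%:~R * v i)); last by move=> i _; rewrite liftK.
move=> h.
(* If [p] divided this coefficient, a relation modulo [p] among the [v i] would remain, and all
   coefficients would be divisible by [p]. *)
have c0 : ~~ (p %| c ord0)%Z.
  apply/negP => /dvdzP[d dp].
  have /vi dv : mulp p%:R G (\sum_i (c (lift ord0 i))%:~R * v i).
    rewrite -[X in mulp _ _ X](addKr ((c ord0)%:~R * a)) addrC.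
    apply: gpG.2 => //; exists (d%:~R * a).
      by rewrite mulrzl; apply: agMz.
    by rewrite dp rmorphM /= mulrAC mulrC mulrA.
  case: ci => i; case: (unliftP ord0 i) => [j ->|->]; first by rewrite dv.
  by rewrite dp dvdz_mull.
have cop : coprimez (c ord0) p by rewrite coprimez_sym coprimezE prime_coprime.
have [[u w] uw] : exists uw : int * int, uw.1 * c ord0 + uw.2 * p = 1.
  by case/coprimezP: cop => -[u w] /= e; exists (u, w).
rewrite /= in uw.
(* [u] inverts the coefficient of [a] modulo [p], so the [e i] are coordinates of [a]; they are then
   reduced to [0, p). *)
pose e i : int := - u * c (lift ord0 i).
have e_ge0 i : (0 <= e i %% p)%Z by rewrite modz_ge0 // -lt0n.
have e_lt i : (`|(e i %% p)%Z| < p)%N.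
  by rewrite -ltz_nat gez0_abs // ltz_pmod // ltz_nat.
exists (\sum_i (`|(e i %% p)%Z|)%:R * v i).
  apply/imageP; exists [ffun i => Ordinal (e_lt i)] => //.
  by apply: eq_bigr => i _; rewrite ffunE.
case: h => g Gg hg.
exists (w%:~R * a + u%:~R * g + \sum_i (e i %/ p)%Z%:~R * v i).
  apply: agD => //; first by apply: agD => //; rewrite mulrzl; apply: agMz.
  by apply: ag_sum => // i _; rewrite mulrzl; apply: agMz.
set P : L := p%:R in hg *.
have uwL : u%:~R * (c ord0)%:~R + w%:~R * P = 1 :> L.
  by rewrite /P (pmulrn 1 p) -!intrM -intrD uw.
rewrite !mulrDr [P * (u%:~R * g)]mulrCA -hg mulrDr !mulr_sumr.
have aE : a = P * (w%:~R * a) + u%:~R * ((c ord0)%:~R * a).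
  by rewrite -[LHS]mul1r -[X in X * _ = _]uwL; ring.
rewrite {1}aE; set S1 := (X in _ - X = _); set S2 := (X in _ = _ + (_ + X) + _); set S3 := (X in _ = _ + X).
suff -> : S1 = - (S2 + S3) by ring.
rewrite -big_split -sumrN; apply: eq_bigr => i _ /=.
have -> : (`|(e i %% p)%Z|)%:R = (e i)%:~R - (e i %/ p)%Z%:~R * P :> L.
  rewrite [(_)%:R]pmulrn (gez0_abs (e_ge0 i)) /P (pmulrn 1 p) -intrM -intrB.
  by rewrite {2}(divz_eq (e i) p) addrC addKr.
by rewrite /e intrM intrN; ring.
Qed.
End FiniteRank.

(** * Finite quotients of a subring, and induction along ideals of finite index *)

Section FiniteQuotients.
Variable L : fieldExtType rat.
Implicit Types (A G H I J M m b : L -> Prop) (a x y z s t : L).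

Lemma fin_idx_nat G n : addgrp G -> (0 < n)%N -> fin_idx G (mulp n%:R G).
Proof.
move=> gG; elim/ltn_ind: n => n IH n0.
case: (ltngtP n 1) => [|n1|->]; first by case: n n0 IH => // -[].
  have pp := pdiv_prime n1; have := pdiv_dvd n; set p := pdiv n in pp * => /dvdnP[k nk].
  have k0 : (0 < k)%N by move: n0; rewrite nk muln_gt0 => /andP[].
  have kn : (k < n)%N by rewrite nk ltn_Pmulr ?prime_gt1.
  have h := fin_idx_mulp k%:R (fin_idx_prime gG pp).
  apply: fin_idx_sup (fin_idx_trans (IH k kn k0) h).
  by move=> _ [_ [g Gg ->] ->]; exists g; rewrite // nk natrM mulrA.
exists [:: 0] => a Ga; exists 0; first exact: mem_head.
by rewrite subr0; exists a => //; rewrite mul1r.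
Qed.

Variable A : L -> Prop.
Hypothesis rA : is_subring A.

(** In an integral relation between powers of [z], cancel the lowest power that occurs: its
    coefficient becomes a multiple of [z] in Z[z]. *)
Lemma nat_multiple z : A z -> z != 0 ->
  exists n : nat, [/\ (0 < n)%N & exists2 y, A y & n%:R = z * y].
Proof.
move=> Az z0.
have [c [c0 e]] := @int_dep L _ (fun i : 'I_(\dim {:L}).+1 => z ^+ i) (ltnSn _).
have [k [kd ck] kmin] : exists2 k, (exists kd : (k < (\dim {:L}).+1)%N, c (Ordinal kd) != 0) &
    forall l, (exists kd : (l < (\dim {:L}).+1)%N, c (Ordinal kd) != 0) -> (k <= l)%N.
  apply: ex_least; case: c0 => i ci; exists i, (ltn_ord i).
  by congr (c _ != 0): ci; apply: val_inj.
pose i0 := Ordinal kd.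
have [y Ay ey] : exists2 y, A y & (c i0)%:~R = z * y.
  exists (- \sum_(i < (\dim {:L}).+1 | i != i0) (c i)%:~R * z ^+ (i - k).-1).
    apply: ringN => //; apply: ag_sum; first exact: ring_ag.
    by move=> i _; apply: ringM => //; [exact: ring_int | exact: ringX].
  have zk : z ^+ k != 0 by apply: expf_neq0.
  apply: (mulIf zk); rewrite mulrN mulNr; apply/eqP; rewrite -addr_eq0.
  move: e; rewrite (bigD1 i0) //= => e; apply/eqP; apply: etrans e; congr (_ + _).
  rewrite -mulrA mulr_suml mulr_sumr; apply: eq_bigr => i ii0.
  case: (eqVneq (c i) 0) => [->|ci]; first by rewrite !mul0r mulr0.
  have ki : (k < i)%N.
    rewrite ltn_neqAle; apply/andP; split.
      by apply: contraNneq ii0 => e; apply/eqP/val_inj.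
    by apply: kmin; exists (ltn_ord i); congr (c _ != 0): ci; apply: val_inj.
  rewrite -mulrA mulrCA -exprD -exprS; congr (_ * z ^+ _).
  by rewrite -addSn prednK ?subn_gt0 // subnK // ltnW.
case: (c i0) ck ey => n; rewrite ?NegzE => n0 ey.
  by exists n; split; [rewrite lt0n | exists y].
exists n.+1; split=> //; exists (- y); first exact: ringN.
by rewrite mulrN -ey mulrNz opprK.
Qed.

Lemma fin_idx_principal z : A z -> z != 0 -> fin_idx A (mulp z A).
Proof.
move=> Az z0; have [n [n0 [y Ay e]]] := nat_multiple Az z0.
apply: fin_idx_sup (fin_idx_nat (ring_ag rA) n0).
by move=> _ [g Gg ->]; exists (y * g); [apply: ringM | rewrite e mulrA].
Qed.

Lemma mulp_sub I x : is_mod A I -> I x -> subp (mulp x A) I.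
Proof. by move=> mI Ix _ [g Ag ->]; apply: modMr mI Ag Ix. Qed.

Lemma fin_idx_mod I x : is_mod A I -> A x -> I x -> x != 0 -> fin_idx A I.
Proof. by move=> mI Ax Ix x0; apply: fin_idx_sup (fin_idx_principal Ax x0); apply: mulp_sub. Qed.

Lemma nat_in_fin_idx I : is_mod A I -> fin_idx A I -> exists2 n : nat, (0 < n)%N & I n%:R.
Proof.
move=> mI [s sP]; have /fin_all_exists[f fP] : forall i : 'I_(size s).+1, exists j : 'I_(size s),
    I ((i : nat)%:R - s`_j).
  move=> i; have [x xs h] := sP _ (ring_nat rA i); move: (xs); rewrite -index_mem => xi.
  by exists (Ordinal xi); rewrite /= nth_index.
have : ~~ injectiveb f.
  apply/negP => /injectiveP/leq_card; by rewrite !card_ord ltnn.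
case/injectivePn => i [j ij eij].
have h : I ((i : nat)%:R - (j : nat)%:R).
  by apply: (agB_trans mI.1 (fP i)); rewrite eij; apply: agBC => //; exact: mI.1.
wlog ji : i j ij eij h / (j < i)%N.
  move=> H; case: (ltngtP j i) => [/H|ji|/val_inj e]; first exact; last by rewrite e eqxx in ij.
  by apply: (H j i) => //; [rewrite eq_sym | apply: agBC => //; exact: mI.1].
by exists (i - j)%N; [rewrite subn_gt0 | rewrite natrB // ltnW].
Qed.

Lemma fin_idx_neq0 I : is_mod A I -> fin_idx A I -> exists2 x, I x & x != 0.
Proof.
move=> mI /(nat_in_fin_idx mI)[n n0 In]; exists n%:R => //.
by rewrite char0_nat -lt0n.
Qed.

(** Finite index is part of the notion and rules out the zero ideal. A subring that is a field has
    no maximal ideals in this sense, and local hypotheses on it are vacuous. *)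
Definition maximal m := [/\ is_ideal A m, ~ m 1, fin_idx A m &
  forall a, A a -> ~ m a -> exists2 c, A c & m (1 - c * a)].

Lemma maximal_ideal m : maximal m -> is_ideal A m. Proof. by case. Qed.
Lemma maximal_mod m : maximal m -> is_mod A m. Proof. by case=> /ideal_mod. Qed.
Lemma maximal_ag m : maximal m -> addgrp m. Proof. by case/maximal_mod. Qed.

(* Climbs a composition series of [A / b]: [b'] is minimal above [b] and [m] is the
   annihilator of the simple module [b' / b]. *)
Lemma ideal_induction (Q : (L -> Prop) -> Prop) :
  (forall b, is_ideal A b -> b 1 -> Q b) ->
  (forall b b' m, is_ideal A b -> is_ideal A b' -> maximal m -> subp b b' ->
     fin_idx A b -> subp (ideal_mul m b') b -> Q b' -> Q b) ->
  forall b, is_ideal A b -> fin_idx A b -> Q b.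
Proof.
move=> Q1 Qstep b ib fb; have mb := ideal_mod ib.
have [n] := fin_index (ring0 rA) mb.1 fb.
elim/ltn_ind: n b ib fb mb => n IH b ib fb mb hn.
case: (classic (b 1)) => b1; first exact: Q1.
have sbA : subp b A := ideal_sub ib.
pose P k := exists2 t, A t /\ ~ b t & index_is (adj A b t) b k.
have madj t : is_mod A (adj A b t) by apply: mod_adj.
have sadj t : A t -> subp (adj A b t) A by move=> At; apply: adj_sub => //; exact: mod_ring.
have [k [t [At bt] hk] kmin] : exists2 k, P k & forall l, P l -> (k <= l)%N.
  apply: ex_least; have [k hk] := fin_index (madj 1).1.1 mb.1 (fin_idx_sub (sadj 1 (ring1 rA)) fb).
  by exists k, 1 => //; split=> //; exact: ring1.
(* By minimality of [k], the quotient of [adj A b t] by [b] is generated by each of its nonzero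
   elements. *)
have msub s : A s -> adj A b t s -> ~ b s -> subp (adj A b t) (adj A b s).
  move=> As ts bs; have sst : subp (adj A b s) (adj A b t).
    by apply: adj_sub => // x; apply: adjS.
  have [u [v [hu hv e]]] := index_factor (madj t).1 (madj s).1 mb.1 sst (@adjS _ _ rA b s) hk.
  have kv : (k <= v)%N by apply: kmin; exists s.
  have v0 : (0 < v)%N := index_gt0 (madj s).1.1 hv.
  apply: index1_sub (madj s).1 (madj t).1.1 _.
  suff <- : u = 1%N by [].
  apply/eqP; rewrite eqn_leq (index_gt0 (madj t).1.1 hu) andbT leqNgt; apply/negP => u1.
  by move: kv; rewrite e leqNgt ltn_Pmull.
pose m a := A a /\ b (a * t).
have mm : maximal m.
  split.
  - split=> [x []//|||].
    + by split; [exact: ring0 | rewrite mul0r; exact: mb.1.1].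
    + by move=> x y [Ax bx] [Ay by']; split; [exact: ringB | rewrite mulrBl; apply: mb.1.2].
    + by move=> a x Aa [Ax bx]; split; [exact: ringM | rewrite -mulrA; apply: modM mb _ _].
  - by case=> _; rewrite mul1r.
  - by apply: fin_idx_sup fb => x bx; split; [exact: sbA | apply: modMr mb _ _].
  - move=> a Aa ma; have bat : ~ b (a * t) by move=> h; apply: ma.
    have h : adj A b t (a * t) by exists a => //; rewrite subrr; exact: mb.1.1.
    have [c Ac hc] := msub _ (ringM rA Aa At) h bat t (adj_gen rA _ mb.1.1).
    exists c => //; split; first by apply: ringB => //; [exact: ring1 | exact: ringM].
    by rewrite mulrBl mul1r -mulrA.
have mbt : subp (ideal_mul m (adj A b t)) b.
  apply: ideal_mul_sub mb.1 _ => x y [Ax bx] [r Ar h].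
  rewrite -(subrK (r * t) y) mulrDr mulrCA; apply: agD mb.1 _ _; first exact: modM mb _ _.
  exact: modM mb _ _.
have iadj : is_ideal A (adj A b t) by apply: mod_ideal (madj t) (sadj t At).
have fadj : fin_idx A (adj A b t) by apply: fin_idx_sup fb; apply: adjS.
apply: (Qstep b (adj A b t) m) => //; first exact: adjS.
have [u [v [hu hv e]]] := index_factor (ring_ag rA) (madj t).1 mb.1 (sadj t At) (@adjS _ _ rA b t) hn.
apply: (IH u) => //.
have u0 := index_gt0 (ring0 rA) hu.
rewrite e ltn_Pmulr //; case: v hv {e} => [|[|v]] // hv.
  by have := index_gt0 (madj t).1.1 hv.
by case: bt; apply: (index1_sub mb.1 (madj t).1.1 hv); apply: adj_gen mb.1.1.
Qed.

End FiniteQuotients.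

(** * Sums of subgroups *)

Section Sum.
Variable L : fieldExtType rat.
Implicit Types (A G H K : L -> Prop).

Definition sump H K : L -> Prop := fun x => exists2 h, H h & K (x - h).

Lemma sump_l H K : addgrp K -> subp H (sump H K).
Proof. by move=> gK x Hx; exists x; rewrite ?subrr //; exact: gK.1. Qed.

Lemma sump_r H K : addgrp H -> subp K (sump H K).
Proof. by move=> gH x Kx; exists 0; [exact: gH.1 | rewrite subr0]. Qed.

Lemma sump_ag H K : addgrp H -> addgrp K -> addgrp (sump H K).
Proof.
move=> gH gK; split; first by apply: sump_l; [exact: gK | exact: gH.1].
move=> x y [h Hh Kh] [k Hk Kk]; exists (h - k); first exact: gH.2.
by have := gK.2 _ _ Kh Kk; congr K; ring.
Qed.

Lemma sump_mod A H K : is_mod A H -> is_mod A K -> is_mod A (sump H K).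
Proof.
move=> mH mK; split; first exact: sump_ag mH.1 mK.1.
by move=> a x Aa [h Hh Kh]; exists (a * h); [apply: mH.2 | rewrite -mulrBr; apply: mK.2].
Qed.

Lemma sump_sub H K G : addgrp G -> subp H G -> subp K G -> subp (sump H K) G.
Proof. by move=> gG sH sK x [h /sH Gh /sK Gx]; rewrite -(subrK h x); apply: agD. Qed.

Lemma sump_mono H K H' K' : subp H H' -> subp K K' -> subp (sump H K) (sump H' K').
Proof. by move=> sH sK x [h /sH Hh /sK Kh]; exists h. Qed.
End Sum.

(** * Gluing local choices of parameters *)

Section Approximation.
Variable L : fieldExtType rat.
Variables (A : L -> Prop) (K : finType) (M C0 : L -> Prop) (X C : K -> L -> Prop).
Hypotheses (rA : is_subring A) (mM : is_mod A M) (mC0 : is_mod A C0).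
Hypotheses (mX : forall i, is_mod A (X i)) (mC : forall i, is_mod A (C i)).
Hypothesis XC : forall i x c, X i x -> C i c -> M (x * c).
Implicit Types (b m : L -> Prop) (x : K -> L).

(** The module C0 + sum_i x_i C_i with parameters x_i in X_i. It covers both uses: generators of an
    ideal (C_i = A), and xJ + yI; the part [C0] holds what has already been fixed. *)
Definition comb x : L -> Prop :=
  fun y => exists2 c : K -> L, (forall i, C i (c i)) & C0 (y - \sum_i x i * c i).

Lemma comb_mod x : is_mod A (comb x).
Proof.
split; first split.
- exists (fun=> 0) => [i|]; first exact: (mC i).1.1.
  by rewrite big1 ?subrr; [exact: mC0.1.1 | move=> i _; rewrite mulr0].
- move=> y z [c Cc h] [d Cd k]; exists (fun i => c i - d i) => [i|]; first exact: (mC i).1.2.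
  have -> : \sum_i x i * (c i - d i) = \sum_i x i * c i - \sum_i x i * d i.
    by rewrite -sumrB; apply: eq_bigr => i _; rewrite mulrBr.
  by have := mC0.1.2 _ _ h k; congr C0; ring.
- move=> a y Aa [c Cc h]; exists (fun i => a * c i) => [i|]; first exact: (mC i).2.
  have -> : \sum_i x i * (a * c i) = a * \sum_i x i * c i.
    by rewrite mulr_sumr; apply: eq_bigr => i _; rewrite mulrCA.
  by rewrite -mulrBr; apply: mC0.2.
Qed.

Definition spans_mod b x := subp M (sump (comb x) (ideal_mul b M)).

(** By [XC], moving each x_i within b X_i moves the combinations only by elements of bM. *)
Lemma spans_mod_change b x x' : is_ideal A b ->
  (forall i, exists2 e, b e & exists2 d, X i d & x' i - x i = e * d) ->
  spans_mod b x' -> spans_mod b x.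
Proof.
move=> ib /fin_all_exists2[e be eP] sx' y /sx' [z [c Cc h] hz].
have [d Xd dE] := fin_all_exists2 eP.
exists (z - \sum_i (x' i - x i) * c i).
  exists c => //; rewrite -addrA -opprD -big_split /=.
  by congr (C0 (_ - _)): h; apply: eq_bigr => i _; rewrite -mulrDl subrK.
rewrite opprB addrCA [_ + (y - z)]addrC; apply: agD => //; first exact: ideal_mul_ag (ideal_mod ib).1.
apply: ag_sum => [|i _]; first exact: ideal_mul_ag (ideal_mod ib).1.
rewrite dE -mulrA; apply: ideal_mulI => //.
exact: XC.
Qed.

(** Substitute M = T + mM, where T is [comb x], into M = T + b'M: the remainder lies in m b' M,
    hence in bM. For b' inside m this is the Nakayama step. *)
Lemma spans_mod_mul b b' m x : is_ideal A b -> is_ideal A b' -> is_ideal A m ->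
  subp (ideal_mul m b') b -> spans_mod b' x -> spans_mod m x -> spans_mod b x.
Proof.
move=> ib ib' im sb sb' sm.
have mT := comb_mod x; have mbM := ideal_mul_mod (ideal_mod ib) mM.1.
have mS := sump_mod mT mbM.
have key : subp (ideal_mul b' M) (sump (comb x) (ideal_mul b M)).
  apply: ideal_mul_sub mS.1 _ => a y b'a /sm [z Tz hz].
  have Aa := ideal_sub ib' b'a.
  exists (a * z); first exact: mT.2.
  rewrite -mulrBr; move: (y - z) hz => w [n [f [g [fm [gM ->]]]]].
  rewrite mulr_sumr; apply: ag_sum => [|i _]; first exact: mbM.1.
  rewrite mulrA [a * _]mulrC; apply: ideal_mulI; last exact: gM.
  by apply/sb/ideal_mulI => //; apply: fm.
move=> y /sb' [z Tz /key [w Tw hw]]; exists (z + w); first exact: agD mT.1 _ _.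
by rewrite opprD addrA.
Qed.

Lemma spans_modW b b' x : subp b b' -> spans_mod b x -> spans_mod b' x.
Proof. by move=> sb h y /h; apply: sump_mono => //; apply: ideal_mulS. Qed.

(* Local solutions are glued by the Chinese remainder theorem, and Nakayama's lemma
   takes care of nilpotents. *)
Lemma approximation :
  (forall m, maximal A m -> exists2 x, (forall i, X i (x i)) & spans_mod m x) ->
  forall b, is_ideal A b -> fin_idx A b -> exists2 x, (forall i, X i (x i)) & spans_mod b x.
Proof.
move=> loc; apply: ideal_induction => // [b ib b1|b b' m ib ib' mm sbb' fb smb [x' Xx' h']].
  exists (fun=> 0) => [i|y My]; first exact: (mX i).1.1.
  exists 0; first exact: (comb_mod _).1.1.
  by rewrite subr0 -[y]mul1r; apply: ideal_mulI.
have im := maximal_ideal mm.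
case: (classic (subp b' m)) => [sb'm|nsub].
  exists x' => //; apply: (spans_mod_mul (m := m) (b' := b')) => //; exact: spans_modW h'.
have [e0 be0 me0] : exists2 e0, b' e0 & ~ m e0.
  by apply: NNPP => no; apply: nsub => z bz; apply: NNPP => mz; apply: no; exists z.
have [_ _ _ /(_ e0 (ideal_sub ib' be0) me0) [c Ac hc]] := mm.
set e := c * e0 in hc; have b'e : b' e by apply: modM (ideal_mod ib') _ _.
have [x'' Xx'' h''] := loc m mm.
(* Here e lies in b' and 1 - e in m, so this tuple is x' modulo b' and x'' modulo m. *)
exists (fun i => (1 - e) * x' i + e * x'' i).
  move=> i; apply: agD (mX i).1 _ _; apply: (mX i).2 => //.
    exact: ideal_sub im _ hc.
  exact: ideal_sub ib' _ b'e.
apply: (spans_mod_mul (m := m) (b' := b')) => //.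
  apply: spans_mod_change h' => // i; exists e => //; exists (x' i - x'' i); first exact: (mX i).1.2.
  by ring.
apply: spans_mod_change h'' => // i; exists (1 - e) => //; exists (x'' i - x' i); first exact: (mX i).1.2.
by ring.
Qed.
End Approximation.

(** * Linear algebra on N / mN for a product N = IJ *)

Section Residue.
Variable L : fieldExtType rat.
Implicit Types (A G H I J M N S m : L -> Prop).

Variables (A m : L -> Prop).
Hypotheses (rA : is_subring A) (mm : maximal A m).

Lemma maximal_div H r s : is_mod A H -> (forall x, m x -> H (x * s)) ->
  A r -> H (r * s) -> ~ m r -> H s.
Proof.
move=> mH mH' Ar Hrs mr; case: mm => _ _ _ /(_ r Ar mr) [c Ac h].
have -> : s = (1 - c * r) * s + c * (r * s) by ring.
by apply: agD mH.1 _ _; [apply: mH' | apply: mH.2].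
Qed.

(** The bound dim N/mN <= 3 over A/m, put as: any three elements independent modulo mN span N modulo
    mN. *)
Definition rank_le3 N := forall s1 s2 s3 s4, N s1 -> N s2 -> N s3 -> N s4 ->
  ~ ideal_mul m N s1 -> ~ adj A (ideal_mul m N) s1 s2 ->
  ~ adj A (adj A (ideal_mul m N) s1) s2 s3 ->
  adj A (adj A (adj A (ideal_mul m N) s1) s2) s3 s4.

(* For [N = I J]: [N = x J + I y + m N]. *)
Definition covers I J N x y := forall S, is_mod A S -> subp (ideal_mul m N) S ->
  (forall w, J w -> S (x * w)) -> (forall v, I v -> S (v * y)) -> subp N S.

Section Covers.
Variables I J N : L -> Prop.
Hypotheses (mJ : is_mod A J) (mN : is_mod A N).
Hypothesis NP : forall v w, I v -> J w -> N (v * w).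
Hypothesis Ngen : forall S, addgrp S -> (forall v w, I v -> J w -> S (v * w)) -> subp N S.
Hypothesis rk : rank_le3 N.
Let D0 := ideal_mul m N.

Let mD0 : is_mod A D0. Proof. exact: ideal_mul_mod (maximal_mod mm) mN.1. Qed.

Lemma exists_product_notin S : ~ (forall v w, I v -> J w -> S (v * w)) ->
  exists v w, [/\ I v, J w & ~ S (v * w)].
Proof.
move=> h; apply: NNPP => no; apply: h => v w Iv Jw; apply: NNPP => h.
by apply: no; exists v, w.
Qed.

Lemma covers_two x w1 w2 : I x -> J w1 -> J w2 -> ~ D0 (x * w1) ->
  ~ adj A D0 (x * w1) (x * w2) -> exists2 y, J y & covers I J N x y.
Proof.
move=> Ix Jw1 Jw2 h1 h2; pose D2 := adj A (adj A D0 (x * w1)) (x * w2).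
have mD1 := mod_adj rA (x * w1) mD0; have mD2 := mod_adj rA (x * w2) mD1.
have sD2 S : is_mod A S -> subp D0 S -> (forall w, J w -> S (x * w)) -> subp D2 S.
  move=> mS sS xS; apply: adj_sub => //; last exact: xS.
  by apply: adj_sub => //; apply: xS.
case: (classic (forall v w, I v -> J w -> D2 (v * w))) => [all|].
  exists 0; first exact: mJ.1.1.
  move=> S mS sS xS _; apply: Ngen mS.1 _ => v w Iv Jw.
  by apply: (sD2 S) => //; apply: all.
case/exists_product_notin=> v [y [Iv Jy h3]]; exists y => // S mS sS xS yS z Nz.
have : adj A D2 (v * y) z by apply: rk => //; exact: NP.
by apply: adj_sub => //; [apply: sD2 | apply: yS].
Qed.
End Covers.

Lemma covers_sym I J N x y : covers I J N x y -> covers J I N y x.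
Proof.
move=> h S mS sS h1 h2; apply: h => // [w Jw|v Iv]; rewrite mulrC; [exact: h2 | exact: h1].
Qed.

(* Over any residue field: two linearly independent products with a common factor
   span a hyperplane, and the second factor is chosen outside of it. *)
Lemma exists_covers I J N : is_mod A I -> is_mod A J -> is_mod A N ->
  (forall v w, I v -> J w -> N (v * w)) ->
  (forall S, addgrp S -> (forall v w, I v -> J w -> S (v * w)) -> subp N S) ->
  rank_le3 N -> exists x y, [/\ I x, J y & covers I J N x y].
Proof.
move=> mI mJ mN NP Ngen rk; pose D0 := ideal_mul m N.
have mD0 : is_mod A D0 by exact: ideal_mul_mod (maximal_mod mm) mN.1.
case: (classic (forall v w, I v -> J w -> D0 (v * w))) => [all|].
  exists 0, 0; split; [exact: mI.1.1 | exact: mJ.1.1 |].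
  by move=> S mS sS _ _; apply: Ngen mS.1 _ => v w Iv Jw; apply/sS/all.
case/exists_product_notin=> v [w [Iv Jw h1]]; pose D1 := adj A D0 (v * w).
have mD1 : is_mod A D1 := mod_adj rA _ mD0.
case: (classic (forall v w, I v -> J w -> D1 (v * w))) => [all|].
  exists v, 0; split=> //; first exact: mJ.1.1.
  move=> S mS sS xS _; apply: Ngen mS.1 _ => v1 w1 Iv1 Jw1.
  suff : subp D1 S by apply; apply: all.
  by apply: adj_sub => //; apply: xS.
case/exists_product_notin=> v' [w' [Iv' Jw' h2]].
case: (classic (D1 (v * w'))) => [vw'|vw']; last first.
  have [y Jy cy] := covers_two mJ mN NP Ngen rk Iv Jw Jw' h1 vw'; by exists v, y.
case: (classic (D1 (v' * w))) => [v'w|v'w]; last first.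
  have [|||||||x Ix cx] := @covers_two J I N mI mN _ _ rk w v v' => //.
  - by move=> a b Ja Ib; rewrite mulrC; apply: NP.
  - by move=> S gS h; apply: Ngen => // a b Ia Jb; rewrite mulrC; apply: h.
  - by rewrite mulrC.
  - by rewrite ![w * _]mulrC.
  by exists x, w; split=> //; apply: covers_sym.
(* Both mixed products lie on the line of v w, so v w and v' w' are independent but share no factor.
   Taking v', or v + v' if v' w vanishes modulo mN, makes v2 w and v2 w' an independent pair with a
   common factor. *)
have [v2 [Iv2 v2w v2wD1 v2w']] : exists v2, [/\ I v2, ~ D0 (v2 * w), D1 (v2 * w) & ~ D1 (v2 * w')].
  case: (classic (D0 (v' * w))) => [d|d]; last by exists v'.
  exists (v + v'); split.
  - exact: agD mI.1 _ _.
  - rewrite mulrDl => h; apply: h1.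
    by rewrite -[v * w](addrK (v' * w)); apply: mD0.1.2.
  - by rewrite mulrDl; apply: agD mD1.1 _ _ => //; apply: adj_gen => //; exact: mD0.1.1.
  - rewrite mulrDl => h; apply: h2.
    by rewrite -[v' * w'](addKr (v * w')) addrC; apply: mD1.1.2.
have [|y Jy cy] := covers_two mJ mN NP Ngen rk Iv2 Jw Jw' v2w.
  apply: contra_not v2w'; apply: adj_sub => //; exact: adjS.
by exists v2, y.
Qed.
End Residue.

(** * Steinitz exchange over the residue field *)

Section Exchange.
Variable L : fieldExtType rat.
Variables (A m : L -> Prop).
Hypotheses (rA : is_subring A) (mm : maximal A m).
Implicit Types (H N : L -> Prop) (l t : seq L).

Definition seq_span H l := foldr (fun s K => adj A K s) H l.

Lemma seq_span_mod H l : is_mod A H -> is_mod A (seq_span H l).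
Proof. by move=> mH; elim: l => //= s l IH; apply: mod_adj. Qed.

Lemma seq_span_mono H H' l : subp H H' -> subp (seq_span H l) (seq_span H' l).
Proof. by move=> sH; elim: l => //= s l IH; apply: adj_mono. Qed.

Lemma seq_span_sub H l : subp H (seq_span H l).
Proof. by elim: l => //= s l IH x /IH; apply: adjS. Qed.

Lemma seq_span_mem H l s : is_mod A H -> s \in l -> seq_span H l s.
Proof.
move=> mH; elim: l => //= x l IH; rewrite inE => /predU1P[->|/IH h].
  by apply: adj_gen => //; exact: (seq_span_mod l mH).1.1.
exact: adjS.
Qed.

Lemma seq_span_least H l G : is_mod A G -> subp H G -> (forall s, s \in l -> G s) ->
  subp (seq_span H l) G.
Proof.
move=> mG sH; elim: l => //= s l IH sl; apply: adj_sub => //.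
  by apply: IH => x xl; apply: sl; rewrite inE xl orbT.
by apply: sl; rewrite mem_head.
Qed.

Fixpoint dependent H t := if t is s :: t' then H s \/ dependent (adj A H s) t' else False.

(** Since [m] maps [l] into [H], the span of [l] modulo [H] is a vector space over A/m, where
    coefficients outside [m] can be inverted. *)
Lemma exchange H l s : is_mod A H -> (forall x y, m x -> y \in l -> H (x * y)) ->
  seq_span H l s -> ~ H s ->
  exists2 l', (size l = (size l').+1) /\ {subset l' <= l} & subp (seq_span H l) (seq_span (adj A H s) l').
Proof.
move=> mH; elim: l => [|a l IH] //= ml hs Hs.
have ml' x y : m x -> y \in l -> H (x * y).
  by move=> mx yl; apply: ml => //; rewrite inE yl orbT.
(* If [s] lies in the span of the tail, the element to discard is found there; otherwise [a] occurs
   in [s] with a coefficient outside [m] and is discarded itself. *)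
case: (classic (seq_span H l s)) => hsl.
  have [l' [sz sl] h] := IH ml' hsl Hs; exists (a :: l'); first split.
  - by rewrite sz.
  - by move=> x; rewrite !inE => /predU1P[->|/sl ->]; rewrite ?eqxx ?orbT.
  - exact: adj_mono.
exists l; first by split=> // x xl; rewrite inE xl orbT.
have mHs := mod_adj rA s mH.
have mS : is_mod A (seq_span (adj A H s) l) by apply: seq_span_mod.
have sS : subp (seq_span H l) (seq_span (adj A H s) l) by apply: seq_span_mono; exact: adjS.
apply: (adj_sub mS sS); case: hs => r Ar h.
have mr : ~ m r.
  move=> mr; apply: hsl; rewrite -(subrK (r * a) s); apply: agD (seq_span_mod l mH).1 _ _ => //.
  by apply: seq_span_sub; apply: ml; rewrite ?mem_head.
apply: (maximal_div mm mS _ Ar _ mr) => [x mx|].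
  by apply/sS/seq_span_sub/ml; rewrite ?mem_head.
rewrite -(subKr s (r * a)); apply: mS.1.2; last exact: sS.
by apply/seq_span_sub/adj_gen => //; exact: mH.1.1.
Qed.

Lemma dependent_span H t l : is_mod A H -> (forall x y, m x -> y \in l -> H (x * y)) ->
  (size l < size t)%N -> (forall s, s \in t -> seq_span H l s) -> dependent H t.
Proof.
elim: t H l => [|s t IH] H l mH ml //= sz tl.
case: (classic (H s)) => Hs; [by left | right].
have [l' [sz' sl] h] := exchange mH ml (tl s (mem_head _ _)) Hs.
apply: (IH _ l'); first exact: mod_adj.
- by move=> x y mx /sl yl; apply: adjS => //; apply: ml.
- by move: sz; rewrite sz' ltnS.
- by move=> x xt; apply/h/tl; rewrite inE xt orbT.
Qed.

(** The three spanning elements may depend on the four given ones. This suits an ideal of an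
    overring of [R]: four of its elements span, up to a denominator, an ideal of [R], to which the
    hypothesis on three generators applies. *)
Lemma rank_le3_span N : is_mod A N ->
  (forall s1 s2 s3 s4, N s1 -> N s2 -> N s3 -> N s4 ->
    exists l, [/\ size l = 3, forall s, s \in l -> N s &
      forall s, s \in [:: s1; s2; s3; s4] -> seq_span (eq^~ 0) l s]) -> rank_le3 A m N.
Proof.
move=> mN gen s1 s2 s3 s4 N1 N2 N3 N4 h1 h2 h3.
have [l [sz lN hl]] := gen _ _ _ _ N1 N2 N3 N4.
have mD := ideal_mul_mod (maximal_mod mm) mN.1.
have : dependent (ideal_mul m N) [:: s1; s2; s3; s4].
  apply: (@dependent_span _ _ l); rewrite ?sz //.
    by move=> x y mx yl; apply: ideal_mulI => //; apply: lN.
  by move=> s /hl; apply: seq_span_mono => x ->; exact: mD.1.1.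
by case=> // -[] // -[] // -[].
Qed.
End Exchange.

(** * From local rank at most 3 to super-multiplicativity *)

Section SuperMultiplicative.
Variable L : fieldExtType rat.
Variable A : L -> Prop.
Hypothesis rA : is_subring A.
Implicit Types (I J : L -> Prop).

(** [approximation] is used twice. Modulo zA, with z nonzero in N = IJ, it gives N = xJ + yI + zN.
    Then x is kept and y is chosen again modulo xA, where the error xN is absorbed by xJ. *)
Lemma exists_factorization I J : is_ideal A I -> is_ideal A J -> fin_idx A (ideal_mul I J) ->
  (forall m, maximal A m -> rank_le3 A m (ideal_mul I J)) ->
  exists x y, [/\ I x, J y, x != 0 &
    subp (ideal_mul I J) (sump (mulp x J) (mulp y I))].
Proof.
move=> iI iJ fIJ rk; have mI := ideal_mod iI; have mJ := ideal_mod iJ.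
have iN := ideal_mul_ideal rA iI iJ; set N := ideal_mul I J in fIJ rk iN *.
have mN := ideal_mod iN.
have [z Nz z0] := fin_idx_neq0 rA mN fIJ.
have Az := ideal_sub iN Nz.
have NI : subp N I by apply: ideal_mul_sub_modl mI _; exact: ideal_sub.
have NJ : subp N J by apply: ideal_mul_sub_mod mJ _; exact: ideal_sub.
have NP v w : I v -> J w -> N (v * w) by exact: ideal_mulI.
have Ngen S : addgrp S -> (forall v w, I v -> J w -> S (v * w)) -> subp N S.
  by move=> gS h; apply: ideal_mul_sub.
have mz := mod_mulp z (mod_ring rA).
have iz : is_ideal A (mulp z A) by apply: mod_ideal mz _; apply: mulp_sub (mod_ring rA) Az.
have m0 : is_mod A (eq^~ (0 : L)).
  by split; [split=> // x y -> ->; rewrite subrr | move=> a x _ ->; rewrite mulr0].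
pose X (b : bool) := if b then I else J; pose C (b : bool) := if b then J else I.
have mX b : is_mod A (X b) by case: b.
have mC b : is_mod A (C b) by case: b.
have [||x Xx hx] := @approximation L A bool N (eq^~ 0) X C rA mN m0 mX mC _ _ (mulp z A) iz (fin_idx_principal rA Az z0).
- by case=> v w; [exact: NP | move=> Jv Iw; rewrite mulrC; apply: NP].
- move=> m mm; have [x [y [Ix Jy cov]]] := exists_covers rA mm mI mJ mN NP Ngen (rk m mm).
  pose u b := if b then x else y; exists u; first by case.
  have mT : is_mod A (comb (eq^~ 0) C u) by apply: comb_mod.
  have mmN := ideal_mul_mod (maximal_mod mm) mN.1.
  apply: cov; first exact: sump_mod.
  + exact: sump_r mT.1.
  + move=> w Jw; apply: sump_l mmN.1 _ _; exists (fun b => if b then w else 0).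
      by case=> //; exact: mI.1.1.
    by rewrite big_bool /= mulr0 addr0 subrr.
  + move=> v Iv; apply: sump_l mmN.1 _ _; exists (fun b => if b then 0 else v).
      by case=> //; exact: mJ.1.1.
    by rewrite big_bool /= mulr0 add0r mulrC subrr.
have {hx Xx} [x1 [y1 [Ix Jy x10 cov]]] : exists x y, [/\ I x, J y, x != 0 &
    forall S, is_mod A S -> subp (mulp x J) S -> subp (mulp y I) S ->
      subp (ideal_mul (mulp z A) N) S -> subp N S].
  have h S : is_mod A S -> subp (mulp (x true) J) S -> subp (mulp (x false) I) S ->
      subp (ideal_mul (mulp z A) N) S -> subp N S.
    move=> mS s1 s2 s3 y /hx; apply: sump_sub mS.1 _ s3 _ => w [c Cc].
    move=> e; rewrite -[w]subr0 -e subKr big_bool; apply: agD mS.1 _ _.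
      by apply: s1; exists (c true) => //; exact: (Cc true).
    by apply: s2; exists (c false) => //; exact: (Cc false).
  (* If x is 0, then xJ contributes nothing and a nonzero element of [I] may take its place. *)
  case: (eqVneq (x true) 0) => [x0|x0].
    exists (z * z), (x false); split; [|exact: (Xx false)|exact: mulf_neq0|].
      exact: (modM mI Az (NI _ Nz)).
    move=> S mS s1 s2 s3; apply: h => // _ [w Jw ->].
    by rewrite x0 mul0r; exact: mS.1.1.
  by exists (x true), (x false); split; [exact: (Xx true) | exact: (Xx false) | |].
have mC0 := mod_mulp x1 mJ.
have Ax := ideal_sub iI Ix.
have ix : is_ideal A (mulp x1 A).
  by apply: mod_ideal (mod_mulp _ (mod_ring rA)) _; apply: mulp_sub (mod_ring rA) Ax.
have [||y Xy hy] := @approximation L A unit N (mulp x1 J) (fun=> J) (fun=> I) rA mN mC0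
   (fun=> mJ) (fun=> mI) _ _ (mulp x1 A) ix (fin_idx_principal rA Ax x10).
- by move=> _ v w Jv Iw; rewrite mulrC; apply: NP.
- move=> m mm; have mmN := ideal_mul_mod (maximal_mod mm) mN.1.
  have mT u : is_mod A (comb (mulp x1 J) (fun=> I) (fun _ : unit => u)).
    exact: (comb_mod mC0 (fun=> mI)).
  have yI u : subp (mulp u I) (sump (comb (mulp x1 J) (fun=> I) (fun _ : unit => u)) (ideal_mul m N)).
    move=> _ [v Iv ->]; apply: sump_l mmN.1 _ _; exists (fun=> v) => //.
    by rewrite (big_pred1 tt) ?subrr; [exact: mC0.1.1 | case].
  case: (classic (m z)) => mz'.
    exists (fun=> y1) => //; apply: cov; first exact: sump_mod.
    + move=> w hw; apply: sump_l mmN.1 _ _; exists (fun=> 0); first by move=> _; exact: mI.1.1.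
      by rewrite big1 ?subr0 // => *; rewrite mulr0.
    + exact: yI.
    + move=> w hw; apply: (sump_r (mT _).1); move: w hw; apply: ideal_mulS => //.
      by apply: mulp_sub (maximal_mod mm) mz'.
  (* When [z] is a unit modulo [m], it serves as y itself: it lies in N, hence in J, and N = zN + mN
     with zN inside zI. *)
  exists (fun=> z) => [_|w Nw]; first exact: NJ.
  have [_ _ _ /(_ z Az mz') [c Ac hc]] := mm.
  have -> : w = z * (c * w) + (1 - c * z) * w by ring.
  apply: agD (sump_mod (mT z) mmN).1 _ _.
    by apply: yI; exists (c * w) => //; apply: modM mI Ac (NI _ Nw).
  by apply: (sump_r (mT z).1); apply: ideal_mulI.
exists x1, (y tt); split=> //.
have mS := sump_mod mC0 (mod_mulp (y tt) mI).
move=> w /hy; apply: sump_sub mS.1 _ _ _.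
  move=> u [c Ic h]; rewrite -(subrK (\sum_i y i * c i) u); apply: agD mS.1 _ _.
    exact: sump_l (mod_mulp (y tt) mI).1 _ h.
  apply: sump_r mC0.1 _ _; exists (c tt); first exact: Ic.
  by rewrite (big_pred1 tt) // => -[].
move=> u hu; apply: (sump_l (mod_mulp (y tt) mI).1).
move: u hu; apply: ideal_mul_sub mC0.1 _ => _ v [a Aa ->] Nv.
by exists (a * v); [apply: modM mJ Aa (NJ _ Nv) | rewrite mulrA].
Qed.

Lemma super_multiplicative_rank_le3 :
  (forall m N, maximal A m -> is_ideal A N -> rank_le3 A m N) -> super_multiplicative A.
Proof.
move=> rk I J iI iJ n hn; have mI := ideal_mod iI; have mJ := ideal_mod iJ.
have iN := ideal_mul_ideal rA iI iJ; have mN := ideal_mod iN; have fN := index_fin hn.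
have gA := ring_ag rA.
have NI : subp (ideal_mul I J) I by apply: ideal_mul_sub_modl mI _; exact: ideal_sub.
have NJ : subp (ideal_mul I J) J by apply: ideal_mul_sub_mod mJ _; exact: ideal_sub.
have [p hp] := fin_index gA.1 mI.1 (fin_idx_sup NI fN).
have [q hq] := fin_index gA.1 mJ.1 (fin_idx_sup NJ fN).
exists p, q; split=> //.
have [x [y [Ix Jy x0 hxy]]] := exists_factorization iI iJ fN (fun m mm => rk m _ mm iN).
have Ax := ideal_sub iI Ix.
have gxA := mulp_ag x gA; have gxJ := mulp_ag x mJ.1.
have [d hd] := fin_index gA.1 gxA (fin_idx_principal rA Ax x0).
have sxAI : subp (mulp x A) I := mulp_sub mI Ix.
have sJA := ideal_sub iJ; have sIA := ideal_sub iI.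
have [p' [e [hp' he ed]]] := index_factor gA mI.1 gxA sIA sxAI hd.
rewrite (index_unique mI.1 hp' hp) {p' hp'} in ed.
have sxJ : subp (mulp x J) (mulp x A) by move=> _ [w Jw ->]; exists w => //; apply: sJA.
have sxJN : subp (mulp x J) (ideal_mul I J) by move=> _ [w Jw ->]; apply: ideal_mulI.
have h1 := index_trans gxA gA (mulp_sub (mod_ring rA) Ax) sxJ gxJ hd (index_mulp x0 mJ.1 hq).
have [n' [f [hn' hf ef]]] := index_factor gA mN.1 gxJ (ideal_sub iN) sxJN h1.
rewrite (index_unique mN.1 hn' hn) in ef.
have fe : (f <= e)%N.
  apply: (index_surj_le (f := fun v => y * v) gxA gxJ he hf).
    move=> u v Iu Iv [a Aa h]; rewrite -mulrBr h mulrCA; exists (y * a) => //.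
    exact: modMr mJ Aa Jy.
  move=> w /hxy [u xu [v Iv h]]; exists v => //.
  by rewrite -h subKr.
have e0 := index_gt0 mI.1.1 he.
(* The count is p q e = d q = n f <= n e, with e positive. *)
by rewrite -(leq_pmul2r e0) mulnAC -ed ef leq_mul2l fe orbT.
Qed.
End SuperMultiplicative.

(** * Algebraic integers and their traces *)

Section Trace.
Variable L : fieldExtType rat.
Implicit Types x y : L.
Let n := \dim {:L}.
Let e := vbasis {:L}.

Definition algint y := exists2 p : {poly int}, p \is monic & root (map_poly intr p) y.

(** The determinant trick in eigenvector form: [y] is an eigenvalue of an integral matrix with row
    eigenvector [v]. *)
Lemma algint_stable k (v : 'I_k -> L) y i0 : v i0 != 0 ->
  (forall i, exists c : 'I_k -> int, y * v i = \sum_j (c j)%:~R * v j) -> algint y.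
Proof.
move=> v0 /fin_all_exists[c cP]; pose C := \matrix_(j < k, i < k) c i j.
exists (char_poly C); first exact: char_poly_monic.
rewrite map_char_poly -eigenvalue_root_char; apply/eigenvalueP.
exists (\row_i v i).
  apply/rowP => i; rewrite !mxE cP; apply: eq_bigr => j _.
  by rewrite !mxE mulrC.
by apply: contraNneq v0 => /rowP/(_ i0); rewrite !mxE => ->.
Qed.

Definition regmx x : 'M[rat]_n := \matrix_(i, j) coord e j (x * e`_i).
Definition trace x : rat := \tr (regmx x).

Lemma coord_e x : x = \sum_(i < n) coord e i x *: e`_i.
Proof. exact: coord_vbasis (memvf x). Qed.

Lemma coord_eE (i j : 'I_n) : coord e j e`_i = (i == j)%:R.
Proof. by rewrite coord_free // (basis_free (vbasisP _)). Qed.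

Lemma traceD x y : trace (x + y) = trace x + trace y.
Proof.
rewrite /trace -mxtraceD; congr (\tr _); apply/matrixP => i j.
by rewrite !mxE mulrDl linearD.
Qed.

Lemma traceZ (q : rat) x : trace (q *: x) = q * trace x.
Proof.
rewrite /trace -mxtraceZ; congr (\tr _); apply/matrixP => i j.
by rewrite !mxE -scalerAl linearZ.
Qed.

Lemma trace0 : trace 0 = 0.
Proof. by rewrite -(scale0r 0) traceZ mul0r. Qed.

Lemma trace_sum (I : Type) (r : seq I) (P : pred I) (F : I -> L) :
  trace (\sum_(i <- r | P i) F i) = \sum_(i <- r | P i) trace (F i).
Proof. exact: (big_morph trace traceD trace0). Qed.

Lemma dim_gt0 : (0 < n)%N. Proof. exact: (adim_gt0 {:L}%AS). Qed.

Lemma trace1 : trace 1 != 0.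
Proof.
have -> : trace 1 = n%:R.
  rewrite /trace /mxtrace (eq_bigr (fun=> 1)) ?sumr_const ?card_ord // => i _.
  by rewrite mxE mul1r coord_eE eqxx.
by rewrite Num.Theory.pnatr_eq0 -lt0n dim_gt0.
Qed.

Lemma regmxM x y : regmx (x * y) = regmx y *m regmx x.
Proof.
apply/matrixP => i j; rewrite !mxE -mulrA [y * _]coord_e mulr_sumr linear_sum /=.
by apply: eq_bigr => k _; rewrite !mxE -scalerAr linearZ.
Qed.

(** Over [algC] the eigenvalues of multiplication by [y] are roots of [p], hence algebraic integers.
    Their sum is a rational algebraic integer. *)
Lemma trace_algint y : algint y -> trace y \is a Num.int.
Proof.
case=> p pmon py; rewrite -(Cint_rat (trace y)); apply: Cint_rat_Aint; first exact: Crat_rat.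
pose Z := map_mx (ratr : rat -> algC) (regmx y).
have -> : ratr (trace y) = \tr Z by rewrite /trace trace_map_mx.
have [r rP] := closed_field_poly_normal (char_poly Z).
rewrite (monicP (char_poly_monic Z)) scale1r in rP.
have sr : size r = n.
  by have := size_char_poly Z; rewrite rP size_prod_XsubC => -[].
have -> : \tr Z = \sum_(z <- r) z.
  apply: oppr_inj; rewrite -char_poly_trace ?dim_gt0 // rP -{1}sr coefPn_prod_XsubC ?sr //.
  by rewrite -lt0n dim_gt0.
rewrite big_seq; apply: rpred_sum => z zr.
have : root (char_poly Z) z by rewrite rP root_prod_XsubC.
rewrite -eigenvalue_root_char => /eigenvalueP[v vZ v0].
apply: (@root_monic_Aint (map_poly intr p)).
(* The eigenvector for z turns multiplication by y^i into z^i, so the relation p(y) = 0 becomes p(z)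
   = 0. *)
- have vZi i : v *m map_mx ratr (regmx (y ^+ i)) = z ^+ i *: v.
    elim: i => [|i IH]; last first.
      by rewrite exprSr regmxM map_mxM mulmxA vZ -scalemxAl IH scalerA exprS.
    rewrite !expr0 scale1r; have -> : regmx 1 = 1%:M.
      by apply/matrixP => i j; rewrite !mxE mul1r coord_eE.
    by rewrite map_scalar_mx rmorph1 mulmx1.
  have : regmx (map_poly intr p).[y] = 0.
    by rewrite (rootP py); apply/matrixP => i j; rewrite !mxE mul0r linear0.
  rewrite horner_coef; set N := size _ => h.
  have {h} h : \sum_(i < N) (p`_i)%:~R *: regmx (y ^+ i) = 0 :> 'M_n.
    apply: etrans h; apply/matrixP => k l; rewrite summxE !mxE mulr_suml linear_sum /=.
    apply: eq_bigr => i _; rewrite !mxE coef_map /= -mulrA.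
    have -> : (p`_i)%:~R * (y ^+ i * e`_k) = ((p`_i)%:~R : rat) *: (y ^+ i * e`_k).
      by rewrite scaler_int mulrzl.
    by rewrite linearZ.
  have := congr1 (fun M => v *m map_mx (ratr : rat -> algC) M) h.
  rewrite map_mx0 mulmx0 raddf_sum mulmx_sumr => hs.
  have {hs} : (\sum_(i < N) (p`_i)%:~R * z ^+ i) *: v = 0.
    apply: etrans hs; rewrite scaler_suml; apply: eq_bigr => i _.
    by rewrite /= map_mxZ -scalemxAr vZi scalerA /= ratr_int.
  move/eqP; rewrite scaler_eq0 (negPf v0) orbF => /eqP hz.
  apply/rootP; rewrite -hz horner_coef.
  have -> : size (map_poly intr p : {poly algC}) = N.
    rewrite /N !size_map_poly_id0 //; rewrite (monicP pmon) oner_neq0 //.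
  by apply: eq_bigr => i _; rewrite coef_map.
- by apply: monic_map.
- by apply/polyOverP => i; rewrite coef_map /= rpred_int.
Qed.
End Trace.

(** * Horner sums of an integral relation *)

Section Horner.
Variable L : fieldExtType rat.
Implicit Types x y z : L.

Lemma algintM x y : algint x -> algint y -> algint (x * y).
Proof. exact: integral_mul. Qed.

Definition powspan n x : L -> Prop :=
  fun z => exists c : 'I_n -> int, z = \sum_j (c j)%:~R * x ^+ j.

Lemma powspan_ag n x : addgrp (powspan n x).
Proof.
split; first by exists (fun=> 0); rewrite big1 // => i _; rewrite mul0r.
move=> _ _ [c ->] [d ->]; exists (fun i => c i - d i).
by rewrite -sumrB; apply: eq_bigr => i _; rewrite intrB mulrBl.
Qed.

Lemma powspan_pow n x i : (i < n)%N -> powspan n x (x ^+ i).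
Proof.
move=> ilt; exists (fun j => (j == Ordinal ilt)%:R).
rewrite (bigD1 (Ordinal ilt)) //= eqxx mul1r big1 ?addr0 // => j /negPf ->.
by rewrite mul0r.
Qed.

(** The multiplier ring of the lattice spanned by 1, ..., x^(n-1). For n > 0 its elements are
    algebraic integers by [algint_stable]. *)
Definition powstab n x : L -> Prop := fun y => forall z, powspan n x z -> powspan n x (y * z).

Lemma powstab_ring n x : is_subring (powstab n x).
Proof.
split=> [z|y z hy hz w hw|y z hy hz w hw]; first by rewrite mul1r.
  by rewrite mulrBl; apply: (powspan_ag n x).2; [apply: hy | apply: hz].
by rewrite -mulrA; apply/hy/hz.
Qed.

Lemma powstabP n x y : (forall i, (i < n)%N -> powspan n x (y * x ^+ i)) -> powstab n x y.
Proof.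
move=> h _ [c ->]; rewrite mulr_sumr; apply: ag_sum => [|i _]; first exact: powspan_ag.
by rewrite mulrCA mulrzl; apply: agMz; [exact: powspan_ag | exact: h].
Qed.

Lemma algint_powstab n x y : (0 < n)%N -> powstab n x y -> algint y.
Proof.
case: n => // n _ h; apply: (@algint_stable _ _ (fun i : 'I_n.+1 => x ^+ i) _ ord0).
  by rewrite expr0 oner_neq0.
by move=> i; apply/h/powspan_pow.
Qed.

(* The partial Horner sums of an integral relation of [x] preserve Z + Z x + ... + Z x^(n-1),
   so they are integral over Z even if [x] is not. *)
Lemma horner_partial n k (c : nat -> int) x i : (k <= n)%N -> (i <= n)%N ->
  \sum_(0 <= l < n.+1) (c l)%:~R * x ^+ l = 0 ->
  powspan n x (\sum_(k <= l < n.+1) (c l)%:~R * x ^+ (l - k) * x ^+ i).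
Proof.
move=> kn ilen rel; have gN := powspan_ag n x.
(* For i < k every exponent l - k + i is below [n]. For i >= k the sum is x^(i-k) times the upper
   part of the relation, that is, minus its lower part, and the exponents become smaller than i. *)
case: (ltnP i k) => ik.
  rewrite big_seq; apply: ag_sum => // l; rewrite mem_index_iota => /andP[kl ln].
  rewrite -mulrA -exprD mulrzl; apply: agMz => //; apply: powspan_pow.
  by rewrite (leq_trans _ (ln : (l <= n)%N)) // -{2}(subnK kl) ltn_add2l.
have -> : \sum_(k <= l < n.+1) (c l)%:~R * x ^+ (l - k) * x ^+ i =
    x ^+ (i - k) * \sum_(k <= l < n.+1) (c l)%:~R * x ^+ l.
  rewrite mulr_sumr; apply: eq_big_nat => l /andP[kl _].
  rewrite -mulrA -exprD mulrCA -exprD; congr (_ * x ^+ _).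
  by rewrite -{1}(subnK ik) addnC -addnA subnKC // addnC.
move: rel; rewrite (big_cat_nat (n := k)) ?(leqW kn) //= => /eqP.
rewrite addrC addr_eq0 => /eqP ->.
rewrite mulrN; apply: agN => //; rewrite mulr_sumr big_seq; apply: ag_sum => // l.
rewrite mem_index_iota /= => lk; rewrite mulrCA -exprD mulrzl; apply: agMz => //.
apply: powspan_pow; rewrite (leq_trans _ ilen) // -{2}(subnK ik) addnC.
by rewrite addnC ltn_add2l.
Qed.

(** The leading coefficient c of a relation of degree k works: c is the top Horner sum, so c x
    preserves the span of 1, ..., x^(k-1). *)
Lemma algint_multiple x : exists2 c : int, c != 0 & algint (c%:~R * x).
Proof.
have [c [[i ci] rel]] := @int_dep L _ (fun i : 'I_(\dim {:L}).+1 => x ^+ i) (ltnSn _).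
pose d := fun l : nat => if insub l is Some j then c j else 0.
have dE (j : 'I_(\dim {:L}).+1) : d j = c j by rewrite /d valK.
have [k [dk kd] kmax] : exists2 k, d k != 0 /\ (k <= \dim {:L})%N &
    forall l, (k < l)%N -> d l = 0.
  have [k [kd dk] kmin] : exists2 k, (k <= \dim {:L})%N /\ d (\dim {:L} - k)%N != 0 &
      forall l, (l <= \dim {:L})%N /\ d (\dim {:L} - l)%N != 0 -> (k <= l)%N.
    apply: ex_least; exists (\dim {:L} - i)%N; rewrite leq_subr subKn ?dE //.
    by rewrite -ltnS.
  exists (\dim {:L} - k)%N; first by rewrite leq_subr.
  move=> l kl; apply/eqP; case: (leqP l (\dim {:L})) => ld; last first.
    by rewrite /d insubF // ltnS leqNgt ld.
  apply/negP => /negP dl; have := kmin (\dim {:L} - l)%N.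
  rewrite leq_subr subKn // => /(_ (conj isT dl)).
  rewrite leqNgt => /negP; apply; rewrite ltn_subLR // addnC -ltn_subLR //.
have {rel} rel : \sum_(0 <= l < k.+1) (d l)%:~R * x ^+ l = 0.
  apply: etrans rel.
  under [RHS]eq_bigr do rewrite -dE.
  rewrite -(big_mkord xpredT (fun l => (d l)%:~R * x ^+ l)).
  rewrite [RHS](big_cat_nat (n := k.+1)) //= [X in _ = _ + X]big_nat_cond.
  by rewrite [X in _ = _ + X]big1 ?addr0 // => l /andP[/andP[/kmax -> _] _]; rewrite mul0r.
exists (d k) => //.
have k0 : (0 < k)%N.
  rewrite lt0n; apply: contraNneq dk => k0; move: rel; rewrite k0 big_nat1 expr0 mulr1 => /eqP.
  by rewrite char0_int.
apply: (algint_powstab (n := k) (x := x) k0); apply: powstabP => j jk.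
have := @horner_partial k k d x j.+1 (leqnn _) jk rel.
by rewrite big_nat1 subnn expr0 mulr1 exprS mulrA.
Qed.
End Horner.

(** * A common denominator for elements whose powers have bounded denominators *)

Section Conductor.
Variable L : fieldExtType rat.
Variable R : L -> Prop.
Hypothesis rR : is_subring R.
Implicit Types x y z : L.

Lemma intr_scale (n : int) y : n%:~R * y = (n%:~R : rat) *: y.
Proof. by rewrite scaler_int mulrzl. Qed.

(** The fraction field of [R]. Natural denominators suffice by [nat_multiple], and with them closure
    under rational scalars is immediate. *)
Definition in_frac y := exists2 n : nat, (0 < n)%N & R (n%:R * y).

Lemma in_fracV y : in_frac y -> in_frac y^-1.
Proof.
move=> [n n0 Rny]; case: (eqVneq y 0) => [->|y0]; first by exists 1%N; rewrite ?invr0 ?mulr0 //; exact: ring0.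
have n0L : n%:R != 0 :> L by rewrite char0_nat -lt0n.
have [k [k0 [w Rw e]]] := nat_multiple rR Rny (mulf_neq0 n0L y0).
exists k => //; rewrite e mulrAC -mulrA -[X in R X]mulrA mulVKf //.
by apply: ringM => //; exact: ring_nat.
Qed.

Lemma in_frac_ag : addgrp in_frac.
Proof.
split; first by exists 1%N; rewrite // mulr0; exact: ring0.
move=> x y [n n0 hn] [k k0 hk]; exists (n * k)%N; first by rewrite muln_gt0 n0.
have -> : (n * k)%:R * (x - y) = k%:R * (n%:R * x) - n%:R * (k%:R * y) by rewrite natrM; ring.
by apply: ringB => //; apply: ringM => //; exact: ring_nat.
Qed.

Lemma in_fracZ (q : rat) y : R y -> in_frac (q *: y).
Proof.
move=> Ry; have d0 := denq_gt0 q; exists `|denq q|%N; first by rewrite absz_gt0 denq_neq0.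
have -> : `|denq q|%:R * (q *: y) = (numq q)%:~R * y.
  have -> : `|denq q|%:R = (denq q)%:~R :> L.
    by rewrite [LHS]pmulrn gez0_abs // Order.POrderTheory.ltW.
  by rewrite [LHS]intr_scale scalerA mulrC -numqE -intr_scale.
by apply: ringM => //; exact: ring_int.
Qed.

(** A maximal Q-independent family of algebraic integers in [R] spans Frac R, because every element
    of Frac R has a nonzero integer multiple that is an algebraic integer in [R]. *)
Lemma exists_basis : exists k (e : 'I_k -> L), [/\ forall i, R (e i), forall i, algint (e i),
  (forall q : 'I_k -> rat, \sum_i q i *: e i = 0 -> forall i, q i = 0) &
  (forall y, in_frac y -> exists q : 'I_k -> rat, y = \sum_i q i *: e i)].
Proof.
pose fam k := exists e : 'I_k -> L, [/\ forall i, R (e i), forall i, algint (e i) &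
  (forall q : 'I_k -> rat, \sum_i q i *: e i = 0 -> forall i, q i = 0)].
have bnd k : fam k -> (k <= \dim {:L})%N.
  case=> e [_ _ h]; rewrite leqNgt; apply/negP => dk.
  have [c [[i ci] rel]] := int_dep e dk.
  have := h (fun i => (c i)%:~R); rewrite (eq_bigr (fun i => (c i)%:~R * e i)) => [/(_ rel i)/eqP|j _].
    by rewrite intr_eq0 (negPf ci).
  by rewrite intr_scale.
have [k [e [Re ae ie]] kmax] : exists2 k, fam k & ~ fam k.+1.
  apply: NNPP => no.
  have : forall k, fam k.
    elim=> [|k IH]; last by apply: NNPP => h; apply: no; exists k.
    by exists (fun=> 0); split=> [[]|[]|q _ []].
  by move/(_ (\dim {:L}).+1)/bnd; rewrite ltnn.
exists k, e; split=> // y [n n0 Rny].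
have n0L : n%:R != 0 :> L by rewrite char0_nat -lt0n.
have [c c0 ac] := algint_multiple (n%:R * y).
set z := c%:~R * (n%:R * y) in ac.
have Rz : R z by apply: ringM => //; exact: ring_int.
have [q [qz rel]] : exists q : 'I_k.+1 -> rat, (exists i, q i != 0) /\
    \sum_i q i *: (if unlift ord0 i is Some j then e j else z) = 0.
  apply: NNPP => no; apply: kmax.
  exists (fun i => if unlift ord0 i is Some j then e j else z); split.
  - by move=> i; case: unliftP.
  - by move=> i; case: unliftP.
  - move=> q rel i; apply/eqP/negP => /negP qi; apply: no; exists q; split=> //; by exists i.
move: rel; rewrite big_ord_recl unlift_none.
rewrite (eq_bigr (fun i => q (lift ord0 i) *: e i)); last by move=> i _; rewrite liftK.
move=> rel; have q0 : q ord0 != 0.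
  apply/eqP => q0; case: qz => i; case: (unliftP ord0 i) => [j ->|->]; last by rewrite q0 eqxx.
  by rewrite (ie (fun j => q (lift ord0 j))) ?eqxx //; move: rel; rewrite q0 scale0r add0r.
pose s : rat := c%:~R * n%:R.
have s0 : s != 0 by rewrite mulf_neq0 ?intr_eq0 // Num.Theory.pnatr_eq0 -lt0n.
have zE : z = s *: y.
  by rewrite /s -scalerA -intr_scale -[n%:R *: y](intr_scale n).
exists (fun i => - (q ord0 * s)^-1 * q (lift ord0 i)).
have qs0 : q ord0 * s != 0 by exact: mulf_neq0.
apply: (scalerI qs0).
rewrite -[LHS]scalerA -zE; move/eqP: rel; rewrite addr_eq0 => /eqP ->.
rewrite scaler_sumr -sumrN; apply: eq_bigr => i _.
by rewrite scalerA mulrA mulrN divff // mulN1r scaleNr.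
Qed.

(* [d] is the discriminant of the trace form on a Q-basis of Frac R consisting of
   algebraic integers of [R]. *)
Lemma exists_discriminant : exists2 d : nat, (0 < d)%N &
  forall y, in_frac y -> algint y -> R (d%:R * y).
Proof.
have [k [e [Re ae ie ge]]] := exists_basis.
pose G := \matrix_(i, j) trace (e i * e j).
have [G' GE] : exists G' : 'M[int]_k, G = map_mx intr G'.
  exists (\matrix_(i, j) Num.floor (trace (e i * e j))); apply/matrixP => i j; rewrite !mxE.
  by rewrite Num.Theory.floorK //; apply/trace_algint/algintM.
(* A kernel vector of [G] gives x with tr(xy) = 0 for all y in Frac R; for y = x^-1 this contradicts
   tr(1) = [L : Q]. *)
have G0 : \det G' != 0.
  apply/negP => /eqP dG; have : \det G == 0 by rewrite GE det_map_mx dG.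
  case/det0P => v v0 vG; pose x := \sum_j v 0 j *: e j.
  have tr0 y : in_frac y -> trace (x * y) = 0.
    move=> /ge[q ->]; rewrite mulr_sumr trace_sum big1 // => i _.
    rewrite -scalerAr traceZ.
    suff -> : trace (x * e i) = (v *m G) 0 i by rewrite vG mxE mulr0.
    rewrite /x mulr_suml trace_sum mxE; apply: eq_bigr => j _.
    by rewrite -scalerAl traceZ mxE.
  have fx : in_frac x by apply: ag_sum => [|j _]; [exact: in_frac_ag | exact: in_fracZ].
  have x0 : x != 0.
    apply: contraNneq v0 => xz; apply/eqP/rowP => j; rewrite mxE.
    by apply: (ie (fun j => v 0 j)).
  by have /eqP := tr0 _ (in_fracV fx); rewrite divff // (negPf (trace1 L)).
exists `|\det G'|%N; first by rewrite absz_gt0.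
move=> y fy ay; suff h : R ((\det G')%:~R * y).
  case: (\det G') h => // n; rewrite NegzE intrN mulNr => /(ringN rR).
  by rewrite opprK abszN.
(* Cramer's rule: the coordinates of y times [G] are the traces of y e_i, which are integers, so the
   determinant clears the denominators of the coordinates. *)
have [q yq] := ge _ fy; pose qv := \row_i q i.
have [b bE] : exists b : 'rV[int]_k, qv *m G = map_mx intr b.
  exists (\row_i Num.floor (trace (y * e i))); apply/rowP => i; rewrite [RHS]mxE [in RHS]mxE.
  rewrite Num.Theory.floorK; last by apply/trace_algint/algintM.
  rewrite mxE yq mulr_suml trace_sum; apply: eq_bigr => j _.
  by rewrite !mxE -scalerAl traceZ.
have qE i : (\det G')%:~R * q i = ((b *m \adj G') 0 i)%:~R.
  have : (\det G) *: qv = map_mx intr (b *m \adj G').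
    by rewrite map_mxM map_mx_adj -bE -GE -mulmxA mul_mx_adj mul_mx_scalar.
  by move/rowP => /(_ i); rewrite !mxE GE det_map_mx.
rewrite yq mulr_sumr; apply: ag_sum => [|i _]; first exact: ring_ag.
have -> : (\det G')%:~R * (q i *: e i) = ((b *m \adj G') 0 i)%:~R * e i.
  by rewrite [LHS]intr_scale scalerA qE -intr_scale.
by apply: ringM => //; exact: ring_int.
Qed.

(** This is R[x], encoded as an intersection of additive groups so that its induction principle
    comes for free. *)
Definition powers_mod x : L -> Prop := fun w =>
  forall G, addgrp G -> (forall i r, R r -> G (r * x ^+ i)) -> G w.

(* If [k] is the largest index with [c_k] prime to [p] in a relation of [x], the Horner sum [u]
   starting at [c_k] is congruent to [c_k] mod [p Z[x]], and [u], [u x] are algebraic integers.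
   After scaling, [u = 1 mod p], so [(1 - (1 - u)^J) x] is an algebraic integer differing
   from [x] by an element of [p^J Z[x]], which lies in [R]. *)
Lemma conductor_prime d p J x : (0 < p)%N -> prime p ->
  (forall y, in_frac y -> algint y -> R (d%:R * y)) ->
  (forall i, R ((p ^ J)%:R * x ^+ i)) -> R (d%:R * x).
Proof.
move=> p0 pp dP Rx.
have [c [[i0 ci0] rel]] := @int_dep_prime L p _ (fun i : 'I_(\dim {:L}).+1 => x ^+ i)
   (prime_gt1 pp) (ltnSn _).
set n := \dim {:L} in c i0 ci0 rel; pose d' := fun l : nat => if insub l is Some j then c j else 0.
have dE (j : 'I_n.+1) : d' j = c j by rewrite /d' valK.
have {}rel : \sum_(0 <= l < n.+1) (d' l)%:~R * x ^+ l = 0.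
  by apply: etrans rel; rewrite big_mkord; apply: eq_bigr => i _; rewrite dE.
have [k [kn dk] kmax] : exists2 k, (k <= n)%N /\ ~~ (p %| d' k)%Z &
    forall l, (k < l <= n)%N -> (p %| d' l)%Z.
  have [k [kn dk] kmin] : exists2 k, (k <= n)%N /\ ~~ (p %| d' (n - k)%N)%Z &
      forall l, (l <= n)%N /\ ~~ (p %| d' (n - l)%N)%Z -> (k <= l)%N.
    apply: ex_least; exists (n - i0)%N; rewrite leq_subr subKn ?dE //.
    by rewrite -ltnS.
  exists (n - k)%N; first by rewrite leq_subr.
  move=> l /andP[kl ln]; apply/negP => /negP dl; have := kmin (n - l)%N.
  rewrite leq_subr subKn // => /(_ (conj isT dl)).
  by rewrite leqNgt => /negP; apply; rewrite ltn_subLR // addnC -ltn_subLR.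
have n0 : (0 < n)%N := dim_gt0 L.
have rS := powstab_ring n x.
pose u := \sum_(k <= l < n.+1) (d' l)%:~R * x ^+ (l - k).
have uE i : (i <= n)%N -> powspan n x (u * x ^+ i).
  by move=> ilen; rewrite mulr_suml; apply: horner_partial.
have Su : powstab n x u by apply: powstabP => i ilt; apply/uE/ltnW.
have Sux : powstab n x (u * x) by apply: powstabP => i ilt; rewrite -mulrA -exprS; apply: uE.
have cop : coprimez (d' k) p by rewrite coprimez_sym coprimezE prime_coprime.
have [a [b ab]] : exists a b : int, a * d' k + b * p = 1.
  by case/coprimezP: cop => -[a b] /= e; exists a, b.
pose S' := powers_mod x.
have gM : addgrp S'.
  split=> [G gG _|y z hy hz G gG h]; first exact: gG.1.
  by apply: gG.2; [apply: hy | apply: hz].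
have pM y : S' y -> R ((p ^ J)%:R * y).
  move=> hy; apply: (hy (fun z => R ((p ^ J)%:R * z))) => [|i r Rr]; last by rewrite mulrCA; apply: ringM.
  split; first by rewrite mulr0; exact: ring0.
  by move=> y1 y2 h1 h2; rewrite mulrBr; apply: ringB.
(* The multiplier ring of R[x] is R[x] again, but in this form it is visibly closed under
   products. *)
pose Z y := forall w, S' w -> S' (y * w).
have rZ : is_subring Z.
  split=> [w|y z hy hz w hw|y z hy hz w hw]; first by rewrite mul1r.
    by rewrite mulrBl; exact: (gM.2 _ _ (hy _ hw) (hz _ hw)).
  rewrite -mulrA; exact: (hy _ (hz _ hw)).
have Zx : Z x.
  move=> w hw G gG h; apply: (hw (fun w => G (x * w))) => [|i r Rr].
    split; first by rewrite mulr0; exact: gG.1.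
    by move=> y1 y2 h1 h2; rewrite mulrBr; apply: gG.2.
  by rewrite mulrCA -exprS; apply: h.
have Z1 y : Z y -> R ((p ^ J)%:R * y).
  by move=> hy; apply: pM; rewrite -[y]mulr1; apply: hy => G _ /(_ 0%N 1 (ring1 rR)); rewrite mul1r.
have [v Zv uv] : exists2 v, Z v & 1 - a%:~R * u = p%:R * v.
  have [v1 Zv1 e1] : exists2 v1, Z v1 & u = (d' k)%:~R + p%:R * v1.
    have [|w wP] := @ClassicalEpsilon.choice nat int (fun l w => (k < l <= n)%N -> d' l = w * p).
      move=> l; case: (boolP (k < l <= n)%N) => [/kmax/dvdzP[w ->]|_]; by [exists w | exists 0].
    exists (\sum_(k.+1 <= l < n.+1) (w l)%:~R * x ^+ (l - k)).
      apply: (ag_sum _ (ring_ag rZ)) => l _.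
      exact: (ringM rZ (ring_int rZ _) (ringX rZ _ Zx)).
    rewrite /u big_ltn ?ltnS // subnn expr0 mulr1 mulr_sumr; congr (_ + _).
    by apply: eq_big_nat => l /wP ->; rewrite intrM (pmulrn 1 p); ring.
  exists (b%:~R - a%:~R * v1).
    exact: (ringB rZ (ring_int rZ _) (ringM rZ (ring_int rZ _) Zv1)).
  have E : a%:~R * (d' k)%:~R + b%:~R * p%:R = 1 :> L.
    by rewrite (pmulrn 1 p) -!intrM -intrD ab.
  by rewrite e1 -[X in X - _]E; ring.
set u1 := a%:~R * u in uv.
have Su1 : powstab n x u1 := ringM rS (ring_int rS _) Su.
pose y := x - (1 - u1) ^+ J * x.
have ay : algint y.
  apply: (algint_powstab n0 (x := x)).
  have -> : y = a%:~R * (u * x) * \sum_(i < J) (1 - u1) ^+ i.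
    have -> : y = (1 - (1 - u1) ^+ J) * x by rewrite /y; ring.
    rewrite -opprB subrX1; set T := \sum_(i < J) _.
    by rewrite /u1; ring.
  apply: (ringM rS (ringM rS (ring_int rS _) Sux)).
  by apply: (ag_sum _ (ring_ag rS)) => i _; apply: (ringX rS); exact: (ringB rS (ring1 rS)).
have Rz : R ((1 - u1) ^+ J * x).
  rewrite uv exprMn -natrX -mulrA; apply: Z1; exact: (ringM rZ (ringX rZ _ Zv) Zx).
have fy : in_frac y.
  exists (p ^ J)%N; first by rewrite expn_gt0 p0.
  rewrite mulrBr; apply: ringB => //; first by have := Rx 1%N; rewrite expr1.
  by apply: ringM => //; exact: ring_nat.
have -> : x = y + (1 - u1) ^+ J * x by rewrite /y subrK.
rewrite mulrDr; apply: ringD => //; first exact: dP.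
by apply: ringM => //; exact: ring_nat.
Qed.

(** Let k be the least positive multiplier taking d x into [R]. If a prime p divides k, write n =
    p^J n' with n' prime to p. Then [conductor_prime] for n' x makes n' a multiplier too, so k
    divides n', which contradicts the choice of n'. *)
Lemma conductor d n x : (0 < n)%N ->
  (forall y, in_frac y -> algint y -> R (d%:R * y)) ->
  (forall i, R (n%:R * x ^+ i)) -> R (d%:R * x).
Proof.
move=> n0 dP Rx.
have [k [k0 Rk] kmin] : exists2 k, (0 < k)%N /\ R (k%:R * (d%:R * x)) &
    forall l, (0 < l)%N /\ R (l%:R * (d%:R * x)) -> (k <= l)%N.
  apply: ex_least; exists n; split=> //.
  have := Rx 1%N; rewrite expr1 => h; rewrite mulrCA; apply: ringM => //; exact: ring_nat.
case: (ltngtP k 1) => [|k1|k1]; first by case: k k0 {Rk kmin} => // -[].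
  exfalso; have pp := pdiv_prime k1; set p := pdiv k in pp.
  have [n' cop nE] := pfactor_coprime pp n0; set J := logn p n in nE.
  have n'0 : (0 < n')%N by move: n0; rewrite nE muln_gt0 => /andP[].
  have Rx' i : R ((p ^ J)%:R * (n'%:R * x) ^+ i).
    case: i => [|i]; first by rewrite expr0 mulr1; exact: ring_nat.
    have -> : (p ^ J)%:R * (n'%:R * x) ^+ i.+1 = n'%:R ^+ i * (n%:R * x ^+ i.+1).
      by rewrite exprMn exprS nE natrM; ring.
    by apply: ringM => //; rewrite -natrX; exact: ring_nat.
  have Rn' := conductor_prime (prime_gt0 pp) pp dP Rx'.
  have kg : (k <= gcdn k n')%N.
    apply: kmin; split; first by rewrite gcdn_gt0 k0.
    have [a [b ab]] : exists a b : int, a * k + b * n' = gcdn k n'.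
      by have [a [b ab]] := Bezoutz k n'; exists a, b.
    have -> : (gcdn k n')%:R = a%:~R * k%:R + b%:~R * n'%:R :> L.
      by rewrite (pmulrn 1 k) (pmulrn 1 n') -!intrM -intrD ab.
    rewrite mulrDl; apply: ringD => //; rewrite -mulrA; apply: ringM => //; try exact: ring_int.
    by rewrite mulrCA.
  have kn' : (k %| n')%N.
    have gk : gcdn k n' = k by apply/eqP; rewrite eqn_leq kg dvdn_leq // dvdn_gcdl.
    by rewrite -gk dvdn_gcdr.
  rewrite prime_coprime // in cop.
  by move/negP: cop => []; apply: dvdn_trans (pdiv_dvd k) kn'.
by move: Rk; rewrite k1 mul1r.
Qed.
End Conductor.

(** * The normalization as a ring of multipliers *)

Section Normal.
Variable L : fieldExtType rat.
Variable R : L -> Prop.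
Hypothesis rR : is_subring R.
Implicit Types (x y z : L) (I N a : L -> Prop).

Definition nonzero I := exists2 z : L, I z & z != 0.

(* An ideal-theoretic description of the integral closure: it makes closure under the ring
   operations immediate. *)
Definition stable x := exists N, [/\ is_ideal R N, nonzero N & forall y, N y -> N (x * y)].

Lemma nonzero_mul I N : nonzero I -> nonzero N -> nonzero (ideal_mul I N).
Proof.
by move=> [x Ix x0] [y Ny y0]; exists (x * y); [apply: ideal_mulI | apply: mulf_neq0].
Qed.

Lemma stable_ring : is_subring stable.
Proof.
split.
- exists R; split; [exact: ideal_ring | by exists 1; [exact: ring1 | exact: oner_neq0] |].
  by move=> y; rewrite mul1r.
- move=> x y [N [iN nN xN]] [N' [iN' nN' yN']].
  have iP := ideal_mul_ideal rR iN iN'; have gP := (ideal_mod iP).1.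
  exists (ideal_mul N N'); split=> //; first exact: nonzero_mul.
  move=> z [n [f [g [fN [gN ->]]]]]; rewrite mulr_sumr; apply: ag_sum => // i _.
  have -> : (x - y) * (f i * g i) = (x * f i) * g i - f i * (y * g i) by ring.
  by apply: gP.2; apply: ideal_mulI; [apply/xN/fN | apply: gN | apply: fN | apply/yN'/gN].
- move=> x y [N [iN nN xN]] [N' [iN' nN' yN']].
  have iP := ideal_mul_ideal rR iN iN'; have gP := (ideal_mod iP).1.
  exists (ideal_mul N N'); split=> //; first exact: nonzero_mul.
  move=> z [n [f [g [fN [gN ->]]]]]; rewrite mulr_sumr; apply: ag_sum => // i _.
  have -> : (x * y) * (f i * g i) = (x * f i) * (y * g i) by ring.
  by apply: ideal_mulI; [apply/xN/fN | apply/yN'/gN].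
Qed.

Lemma stable_sub : subp R stable.
Proof.
move=> x Rx; exists R; split; [exact: ideal_ring | by exists 1; [exact: ring1 | exact: oner_neq0] |].
by move=> y; apply: ringM.
Qed.

Lemma stable_powers x : stable x -> exists2 n : nat, (0 < n)%N & forall i, R (n%:R * x ^+ i).
Proof.
case=> N [iN [z Nz z0] xN]; have Rz := ideal_sub iN Nz.
have [n [n0 [y Ry e]]] := nat_multiple rR Rz z0; exists n => // i.
rewrite e mulrAC mulrC; apply: ringM => //; apply: (ideal_sub iN).
by elim: i => [|i IH]; [rewrite mulr1 | rewrite exprS mulrCA; apply: xN].
Qed.

Lemma stable_conductor : exists2 d : nat, (0 < d)%N & forall x, stable x -> R (d%:R * x).
Proof.
have [d d0 dP] := exists_discriminant rR; exists d => // x /stable_powers[n n0 h].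
exact: conductor n0 dP h.
Qed.

(** The classes of n x^i in the finite ring R/nR repeat, so two powers of x differ by an element of
    [R], which is a monic relation. *)
Lemma stable_normalization x : stable x -> normalization R x.
Proof.
move=> sx; split.
  have [d d0 h] := stable_conductor; exists (d%:R * x), d%:R.
  have d0L : d%:R != 0 :> L by rewrite char0_nat -lt0n.
  split=> //; [exact: h | exact: ring_nat | by rewrite mulrC mulKf].
have [n n0 h] := stable_powers sx.
have n0L : n%:R != 0 :> L by rewrite char0_nat -lt0n.
have [s sP] := fin_idx_principal rR (ring_nat rR n) n0L.
have /fin_all_exists[f fP] : forall i : 'I_(size s).+1, exists j : 'I_(size s),
    mulp n%:R R (n%:R * x ^+ i - s`_j).
  move=> i; have [w ws hw] := sP _ (h i); move: (ws); rewrite -index_mem => wi.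
  by exists (Ordinal wi); rewrite /= nth_index.
have : ~~ injectiveb f.
  apply/negP => /injectiveP/leq_card; by rewrite !card_ord ltnn.
case/injectivePn => i [j ij eij].
have gM := mulp_ag n%:R (ring_ag rR).
have hij : mulp n%:R R (n%:R * x ^+ i - n%:R * x ^+ j).
  by apply: (agB_trans gM (fP i)); rewrite eij; apply: (agBC gM); apply: fP.
wlog ji : i j ij eij hij / (j < i)%N.
  move=> H; case: (ltngtP j i) => [/H|ji|/val_inj e]; first exact; last by rewrite e eqxx in ij.
  by apply: (H j i) => //; [rewrite eq_sym | apply: (agBC gM)].
case: hij => r Rr; rewrite -mulrBr => /(mulfI n0L) e.
have sq : (size ('X^j + r%:P : {poly L})%R < size ('X^i : {poly L})%R)%N.
  rewrite size_polyXn ltnS (leq_trans (size_polyD _ _)) // geq_max size_polyXn ji /=.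
  by rewrite (leq_trans (size_polyC_leq1 _)) // (leq_ltn_trans _ ji).
exists ('X^i - ('X^j + r%:P)); split.
- by rewrite monicE lead_coefDl ?size_polyN // lead_coefXn.
- move=> k; rewrite coefB coefD !coefXn coefC.
  apply: ringB => //; first exact: ring_nat.
  by apply: ringD => //; [exact: ring_nat | case: ifP => // _; exact: ring0].
- by apply/rootP; rewrite !hornerE -e; ring.
Qed.

(** The conductor [d] moves [I] to a nonzero ideal dI of [R], still preserved by x. This is the form
    of normality used to invert ideals. *)
Lemma stable_closed x I : is_ideal stable I -> nonzero I ->
  (forall y, I y -> I (x * y)) -> stable x.
Proof.
move=> iI [z Iz z0] xI; have [d d0 h] := stable_conductor.
have d0L : d%:R != 0 :> L by rewrite char0_nat -lt0n.
exists (mulp d%:R I); split.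
- apply: mod_ideal; last by move=> _ [y Iy ->]; apply/h/(ideal_sub iI).
  by apply: mod_mulp; apply: mod_sub stable_sub _; exact: ideal_mod iI.
- by exists (d%:R * z); [exists z | exact: mulf_neq0].
- by move=> _ [y Iy ->]; exists (x * y); [apply: xI | rewrite mulrCA].
Qed.
End Normal.

(** * Invertibility of nonzero ideals of a normal ring *)

Section Invertible.
Variable L : fieldExtType rat.
Variable A : L -> Prop.
Hypothesis rA : is_subring A.
Implicit Types (x y z s : L) (I b c : L -> Prop).

(* [T s] says that [s] vanishes in the localisation of [A / c] at [1 + b]; multiplying by
   maximal powers of generators of [b] that stay outside [T] yields [s]. *)
Lemma exists_annihilator b c : is_ideal A b -> is_ideal A c -> subp c b -> fin_idx A c ->
  ~ b 1 -> exists s, [/\ A s, ~ c s & forall y, b y -> c (s * y)].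
Proof.
move=> ib ic scb fc b1; have mb := ideal_mod ib; have mc := ideal_mod ic.
pose T s := exists2 u, b u & c ((1 - u) * s).
have A1u u : b u -> A (1 - u) by move=> /(ideal_sub ib) Au; apply: ringB => //; exact: ring1.
have Tmul u s : A s -> b u -> T ((1 - u) * s) -> T s.
  move=> As bu [w bw h]; exists (u + w - w * u).
    apply: (mb.1.2); first exact: agD mb.1 _ _.
    by apply: modM mb _ bu; exact: ideal_sub ib _ bw.
  by have -> : (1 - (u + w - w * u)) * s = (1 - w) * ((1 - u) * s) by ring.
have key (l : seq L) : (forall y, y \in l -> b y) -> exists s, [/\ A s, ~ T s & forall y, y \in l -> c (s * y)].
  elim: l => [_|y l IH bl].
    exists 1; split=> //; first exact: ring1.
    move=> [u bu]; rewrite mulr1 => /scb h; apply: b1.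
    by rewrite -(subrK u 1); apply: agD mb.1 _ _.
  have by' : b y by apply: bl; rewrite mem_head.
  have Ay := ideal_sub ib by'.
  have [w wl|s [As Ts hs]] := IH; first by apply: bl; rewrite inE wl orbT.
  (* Some power of y brings s into [T]: modulo [c] two elements y^i s and y^j s with i < j agree,
     and then 1 - y^(j-i) sends y^i s into [c]. *)
  have [k Tk kmin] : exists2 k, T (y ^+ k * s) & forall l, T (y ^+ l * s) -> (k <= l)%N.
    apply: ex_least; apply: NNPP => no.
    have [r rP] := fc.
    have /fin_all_exists[f fP] : forall i : 'I_(size r).+1, exists j : 'I_(size r),
        c (y ^+ i * s - r`_j).
      move=> i; have [|w ws hw] := rP (y ^+ i * s); first by apply: ringM => //; exact: ringX.
      move: (ws); rewrite -index_mem => wi.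
      by exists (Ordinal wi); rewrite /= nth_index.
    have : ~~ injectiveb f by apply/negP => /injectiveP/leq_card; rewrite !card_ord ltnn.
    case/injectivePn => i [j ij eij].
    have h : c (y ^+ i * s - y ^+ j * s).
      by apply: (agB_trans mc.1 (fP i)); rewrite eij; apply: agBC; [exact: mc.1 | exact: fP].
    wlog ji : i j ij eij h / (i < j)%N.
      move=> H; case: (ltngtP i j) => [/H|ji|/val_inj e]; first exact; last by rewrite e eqxx in ij.
      by apply: (H j i) => //; [rewrite eq_sym | apply: agBC; first exact: mc.1].
    apply: no; exists i, (y ^+ (j - i)).
      rewrite -(prednK (_ : 0 < j - i)%N) ?subn_gt0 // exprSr; apply: modM mb _ by'.
      exact: ringX.
    rewrite mulrA mulrBl mul1r -exprD subnK ?mulrBl //; exact: ltnW.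
  case: k Tk kmin => [|k]; first by rewrite mul1r.
  move=> [u bu hu] kmin.
  exists ((1 - u) * (y ^+ k * s)); split.
  - apply: ringM => //; first exact: A1u.
    by apply: ringM => //; exact: ringX.
  - move/Tmul => h; have : T (y ^+ k * s).
      by apply: h => //; apply: ringM => //; exact: ringX.
    by move/kmin; rewrite ltnn.
  - move=> w; rewrite inE => /predU1P[->|/hs h].
      by have -> : (1 - u) * (y ^+ k * s) * y = (1 - u) * (y ^+ k.+1 * s) by rewrite exprSr; ring.
    have -> : (1 - u) * (y ^+ k * s) * w = ((1 - u) * y ^+ k) * (s * w) by ring.
    by apply: modM mc _ h; apply: ringM => //; [exact: A1u | exact: ringX].
have [l lP] := fin_idx_sub (ideal_sub ib) fc.
have [g gP] := fin_index mb.1.1 mc.1 (ex_intro _ l lP).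
case: gP => r [szr br _ rsur].
have [s [As Ts hs]] : exists s, [/\ A s, ~ T s & forall y, y \in r -> c (s * y)].
  by apply: key => y /(nthP 0)[i]; rewrite szr => ig <-; apply: br.
exists s; split=> //.
  by move=> cs; apply: Ts; exists 0; [exact: mb.1.1 | rewrite subr0 mul1r].
move=> y /rsur[i ig h]; rewrite -(subrK r`_i y) mulrDr; apply: agD mc.1 _ _.
  exact: modM mc As h.
by apply: hs; rewrite mem_nth // szr.
Qed.

Hypothesis normal : forall x I, is_ideal A I -> nonzero I ->
  (forall y, I y -> I (x * y)) -> A x.

Definition inv_ideal I : L -> Prop := fun w => forall y, I y -> A (w * y).

Lemma inv_ideal_mod I : is_ideal A I -> is_mod A (inv_ideal I).
Proof.
move=> iI; split; first split.
- by move=> y _; rewrite mul0r; exact: ring0.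
- by move=> u v hu hv y Iy; rewrite mulrBl; apply: ringB => //; [apply: hu | apply: hv].
- by move=> a u Aa hu y Iy; rewrite -mulrA; apply: ringM => //; apply: hu.
Qed.

(** Let b = I I^-1 and z in I be nonzero. If b is proper, some s outside zA satisfies s b inside zA.
    Then s/z maps b into A, hence I^-1 into itself, and normality applied to the ideal z I^-1 puts
    s/z in A, a contradiction. *)
Lemma invertible I : is_ideal A I -> nonzero I -> ideal_mul I (inv_ideal I) 1.
Proof.
move=> iI [z Iz z0]; have mI := ideal_mod iI; have mV := inv_ideal_mod iI.
set b := ideal_mul I (inv_ideal I).
have mb : is_mod A b by exact: ideal_mul_mod mI mV.1.
have sbA : subp b A.
  by apply: ideal_mul_sub (ring_ag rA) _ => x w Ix hw; rewrite mulrC; apply: hw.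
have ib : is_ideal A b := mod_ideal mb sbA.
have Az := ideal_sub iI Iz.
have bz : b z.
  by rewrite -[z]mulr1; apply: ideal_mulI => // y Iy; rewrite mul1r; exact: ideal_sub iI _ Iy.
apply: NNPP => b1.
have mz := mod_mulp z (mod_ring rA).
have iz : is_ideal A (mulp z A) by apply: mod_ideal mz _; apply: mulp_sub (mod_ring rA) Az.
have [s [As cs hs]] := exists_annihilator ib iz (mulp_sub mb bz) (fin_idx_principal rA Az z0) b1.
apply: cs; suff h : A (s / z) by exists (s / z); rewrite // mulrC divfK.
have hb y : b y -> A (s / z * y).
  by move/hs=> [w Aw e]; rewrite mulrAC e mulrC mulKf.
have hV w : inv_ideal I w -> inv_ideal I (s / z * w).
  by move=> hw y Iy; rewrite -mulrA; apply: hb; rewrite mulrC; apply: ideal_mulI.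
apply: (normal (I := mulp z (inv_ideal I))).
- apply: mod_ideal (mod_mulp z mV) _ => _ [w hw ->].
  by rewrite mulrC; apply: hw.
- by exists z => //; exists 1; rewrite ?mulr1 // => y /(ideal_sub iI); rewrite mul1r.
- by move=> _ [w /hV hw ->]; exists (s / z * w); rewrite // mulrCA.
Qed.

Lemma invertible_generator I P : is_ideal A I -> ideal_mul I (inv_ideal I) 1 ->
  is_mod A P -> ~ P 1 -> exists2 u, I u & exists2 w, inv_ideal I w & ~ P (u * w).
Proof.
move=> iI h mP P1; apply: NNPP => no; apply: P1.
apply: (ideal_mul_sub mP.1 _ h) => u w Iu hw; apply: NNPP => Pu.
by apply: no; exists u => //; exists w.
Qed.

(** If u w is invertible modulo [P], then [u] alone generates [I] up to PI. *)
Lemma invertible_decomp I P u w : is_ideal A I -> I u -> inv_ideal I w ->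
  (exists2 c, A c & P (1 - c * (u * w))) ->
  subp I (sump (mulp u A) (ideal_mul P I)).
Proof.
move=> iI Iu hw [c Ac hc] x Ix; exists (u * (c * (w * x))).
  by exists (c * (w * x)) => //; apply: ringM => //; apply: hw.
have -> : x - u * (c * (w * x)) = (1 - c * (u * w)) * x by ring.
exact: ideal_mulI.
Qed.
End Invertible.

(** * The bound [I : mI] <= [A : mA] *)

Section Bound.
Variable L : fieldExtType rat.
Variables R A m : L -> Prop.
Hypotheses (rR : is_subring R) (rA : is_subring A) (sRA : subp R A).
Hypothesis normal : forall x I, is_ideal A I -> nonzero I ->
  (forall y, I y -> I (x * y)) -> A x.
Hypothesis mm : maximal R m.
Variable d : nat.
Hypotheses (d0 : (0 < d)%N) (dA : forall x, A x -> R (d%:R * x)).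
Implicit Types (x y z u w : L) (I F P G H : L -> Prop).

Lemma index_full G H n : addgrp G -> subp G H -> index_is G H n -> (n <= 1)%N.
Proof.
move=> gG sGH [s [_ sG sinj _]]; rewrite leqNgt; apply/negP => n1.
have n0 : (0 < n)%N by apply: ltn_trans n1.
by have := sinj 0 1 n0 n1 (sGH _ (gG.2 _ _ (sG _ n0) (sG _ n1))).
Qed.

Definition extended := ideal_mul m A.
Let M := extended.

Lemma extended_mod : is_mod A M.
Proof. exact: ideal_mul_mod_r (maximal_ag mm) (mod_ring rA). Qed.

Lemma extended_sub : subp m M.
Proof. by move=> x mx; rewrite -[x]mulr1; apply: ideal_mulI => //; exact: ring1. Qed.

Lemma extended_ideal : is_ideal A M.
Proof.
apply: mod_ideal extended_mod _; apply: ideal_mul_sub (ring_ag rA) _ => x y mx Ay.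
by apply: ringM => //; apply/sRA/(ideal_sub (maximal_ideal mm)).
Qed.

Lemma maximal_nonzero : nonzero m.
Proof.
have [_ _ fm _] := mm.
by have [z mz z0] := fin_idx_neq0 rR (maximal_mod mm) fm; exists z.
Qed.

Lemma extended_nonzero : nonzero M.
Proof. by have [z mz z0] := maximal_nonzero; exists z => //; apply: extended_sub. Qed.

Lemma extended_invertible : ideal_mul M (inv_ideal A M) 1.
Proof. exact: (invertible rA normal extended_ideal extended_nonzero). Qed.

(** A local generator of M = mA can be found in [m] itself, since [m] generates M. Multiplication by
    it then sends I into mI as well as F into MF. *)
Lemma extended_generator P : maximal A P ->
  exists2 u, m u & subp M (sump (mulp u A) (ideal_mul P M)).
Proof.
move=> mP; have [iP P1 _ Pmax] := mP.
have [u mu [w hw Pu]] : exists2 u, m u & exists2 w, inv_ideal A M w & ~ P (u * w).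
  apply: NNPP => no; apply: P1; have gP := maximal_ag mP.
  apply: (ideal_mul_sub gP _ extended_invertible) => x w Mx hw.
  move: x Mx; apply: (@ideal_mul_sub _ _ _ (fun x => P (x * w))).
    split; first by rewrite mul0r; exact: gP.1.
    by move=> x y hx hy; rewrite mulrBl; apply: gP.2.
  move=> u a mu Aa; apply: NNPP => Pu; apply: no; exists u => //; exists (a * w).
    by move=> y My; rewrite -mulrA; apply: ringM => //; apply: hw.
  by rewrite mulrA.
have Mu := extended_sub mu; exists u => //.
apply: (invertible_decomp rA extended_ideal Mu hw); apply: Pmax => //.
by rewrite mulrC; apply: hw.
Qed.

(* Compares graded pieces along a filtration of [A] by [A]-ideals [F]: multiplication by a suitable
   [u] in [m] maps F'/F onto MF'/MF and respects the images of [I] and [m I]. This avoids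
   a principal reduction of [m], which need not exist over a small residue field. *)
Lemma extended_index_le I F a b : is_ideal R I -> is_ideal A F -> fin_idx A F ->
  index_is A (sump I F) a -> index_is M (sump (ideal_mul m I) (ideal_mul M F)) b -> (b <= a)%N.
Proof.
move=> iI iF fF; move: F iF fF a b; have gI := (ideal_mod iI).1; have sIA x (h : I x) := sRA (ideal_sub iI h).
have gM := extended_mod.1; have gmI := ideal_mul_ag I (maximal_ag mm); have gA := ring_ag rA.
have gMF F := ideal_mul_ag F gM.
have gH F := sump_ag gmI (gMF F).
have sMA : subp M A := ideal_sub extended_ideal.
have smIM : subp (ideal_mul m I) M by apply: ideal_mulS.
apply: (ideal_induction rA) => [F iF F1 a b ha hb|F F' P iF iF' mP sFF' fF sPF IH a b ha hb].
  apply: leq_trans (index_gt0 (ring0 rA) ha); apply: index_full hb => // x Mx.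
  by apply: sump_r => //; rewrite -[x]mulr1; apply: ideal_mulI.
have gF := (ideal_mod iF).1; have gF' := (ideal_mod iF').1.
have sIFA : subp (sump I F') A by apply: sump_sub => //; exact: ideal_sub.
have sIFF : subp (sump I F) (sump I F') by apply: sump_mono.
have [a1 [a2 [ha1 ha2 ->]]] := index_factor gA (sump_ag gI gF') (sump_ag gI gF) sIFA sIFF ha.
have sHM : subp (sump (ideal_mul m I) (ideal_mul M F')) M.
  apply: sump_sub => //; apply: ideal_mul_sub => // x y Mx F'y.
  by apply: modMr extended_mod _ Mx; exact: ideal_sub iF' _ F'y.
have sHH : subp (sump (ideal_mul m I) (ideal_mul M F)) (sump (ideal_mul m I) (ideal_mul M F')).
  by apply: sump_mono => //; apply: ideal_mulS.
have [b1 [b2 [hb1 hb2 ->]]] := index_factor gM (gH F') (gH F) sHM sHH hb.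
apply: leq_mul; first exact: IH ha1 hb1.
have [u mu Mu] := extended_generator mP.
have uI x : I x -> ideal_mul m I (u * x) by exact: ideal_mulI.
have uF G x : G x -> ideal_mul M G (u * x) by move=> Gx; apply: ideal_mulI => //; exact: extended_sub.
(* M is uA + PM, and P F' lies in F, so the part PM F' falls into MF. *)
have MF' : subp (ideal_mul M F') (sump (mulp u F') (ideal_mul M F)).
  have gS : addgrp (sump (mulp u F') (ideal_mul M F)) by apply: sump_ag => //; exact: mulp_ag.
  apply: ideal_mul_sub => // x y Mx F'y; have [_ [a0 Aa0 ->] h] := Mu x Mx.
  rewrite -(subrK (u * a0) x) mulrDl addrC; apply: agD gS _ _.
    apply: sump_l => //; exists (a0 * y); last by rewrite mulrA.
    exact: modM (ideal_mod iF') _ _.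
  apply: sump_r; first exact: mulp_ag.
  have gT : addgrp (fun z => ideal_mul M F (z * y)).
    split; first by rewrite mul0r; exact: (gMF F).1.
    by move=> z t hz ht; rewrite mulrBl; apply: (gMF F).2.
  apply: (ideal_mul_sub gT _ h) => p z Pp Mz; rewrite mulrAC mulrC.
  by apply: ideal_mulI => //; apply/sPF/ideal_mulI.
apply: (index_surj_le (f := fun x => u * x) (sump_ag gI gF) (gH F) ha2 hb2).
  move=> x y _ _ [h Ih Fh]; rewrite -mulrBr -(subrK h (x - y)) mulrDr addrC.
  apply: (agD (gH F)); first by apply: sump_l => //; apply: uI.
  by apply: sump_r => //; apply: uF.
move=> y [h hI /MF'[_ [x F'x ->] hx]]; exists x; first exact: sump_r.
have -> : y - u * x = h + (y - h - u * x) by ring.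
by apply: (agD (gH F)); [apply: sump_l | apply: sump_r].
Qed.

(** The chains from mI to A through I and through M give [A : I][I : mI] = [A : M][M : mI], so it
    suffices that [M : mI] <= [A : I]. *)
Lemma index_mul_le I q n : is_ideal R I -> nonzero I -> index_is A M q ->
  index_is I (ideal_mul m I) n -> (n <= q)%N.
Proof.
move=> iI [z Iz z0] hq hn.
have gM := extended_mod.1; have gmI := ideal_mul_ag I (maximal_ag mm); have gA := ring_ag rA.
have mI := ideal_mod iI.
have dL : d%:R != 0 :> L by rewrite char0_nat -lt0n.
(* Since dA lies in [R], the A-ideal dzA lies in [I], and its product with M lies in mI; so [F]
   disappears from both sums in [extended_index_le]. *)
pose F := mulp (d%:R * z) A; have Adz : A (d%:R * z).
  by apply: ringM => //; [exact: ring_nat | apply/sRA/(ideal_sub iI)].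
have mF : is_mod A F by apply: mod_mulp (mod_ring rA).
have iF : is_ideal A F by apply: mod_ideal => //; apply: mulp_sub (mod_ring rA) _.
have fF : fin_idx A F by apply: fin_idx_principal => //; exact: mulf_neq0.
have sFI : subp F I.
  by move=> _ [a Aa ->]; rewrite mulrAC; apply: modM mI _ Iz; exact: dA.
have fI : fin_idx A I := fin_idx_sup sFI fF.
have sMF : subp (ideal_mul M F) (ideal_mul m I).
  apply: ideal_mul_sub => // x _ Mx [a Aa ->].
  have gT : addgrp (fun x => ideal_mul m I (x * (d%:R * z * a))).
    split; first by rewrite mul0r; exact: gmI.1.
    by move=> u v hu hv; rewrite mulrBl; apply: gmI.2.
  apply: (ideal_mul_sub gT _ Mx) => u v mu Av; rewrite -[u * v * _]mulrA; apply: ideal_mulI => //.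
  have : I (d%:R * (v * a) * z) by apply: modM mI _ Iz; apply: dA; apply: (ringM rA).
  by congr I; ring.
have sIA : subp I A by move=> x /(ideal_sub iI)/sRA.
have smI : subp (ideal_mul m I) I.
  by apply: ideal_mul_sub_mod mI _; exact: ideal_sub (maximal_ideal mm).
have smIM : subp (ideal_mul m I) M by apply: ideal_mulS.
have [a ha] := fin_index gA.1 mI.1 fI.
have h1 := index_trans mI.1 gA sIA smI gmI ha hn.
have [q' [b [hq' hb e]]] := index_factor gA gM gmI (ideal_sub extended_ideal) smIM h1.
rewrite (index_unique gM hq' hq) in e.
have ba : (b <= a)%N.
  apply: (extended_index_le iI iF fF).
    apply: (index_ext mI.1 (sump_ag mI.1 mF.1) ha) => // x; split; first exact: (sump_l mF.1).
    exact: (sump_sub mI.1 (fun _ h => h) sFI).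
  apply: (index_ext gmI (sump_ag gmI (ideal_mul_ag F gM)) hb) => // x.
  split; first exact: (sump_l (ideal_mul_ag F gM)).
  exact: (sump_sub gmI (fun _ h => h) sMF).
have a0 := index_gt0 gA.1 ha.
by rewrite -(leq_pmul2l a0) e mulnC leq_mul2r ba orbT.
Qed.
End Bound.

(** * Two ideals of R + M that violate super-multiplicativity *)

Section Violation.
Variable L : fieldExtType rat.
Variables R A m : L -> Prop.
Hypotheses (rR : is_subring R) (rA : is_subring A) (sRA : subp R A).
Hypothesis normal : forall x I, is_ideal A I -> nonzero I ->
  (forall y, I y -> I (x * y)) -> A x.
Hypothesis mm : maximal R m.
Implicit Types (x y z u v w : L) (F G H V W : L -> Prop).

Let M := extended A m.
Let M2 := ideal_mul M M.
Let M3 := ideal_mul M M2.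
Let mM : is_mod A M := extended_mod rA mm.
Let iM : is_ideal A M := extended_ideal rA sRA mm.
Let mM2 : is_mod A M2 := ideal_mul_mod mM mM.1.
Let mM3 : is_mod A M3 := ideal_mul_mod mM mM2.1.
Let sMA : subp M A := ideal_sub iM.
Let sM2 : subp M2 M := ideal_mul_sub_mod mM sMA.
Let sM3 : subp M3 M2 := ideal_mul_sub_mod mM2 sMA.
Let mMR : is_mod R M := mod_sub sRA mM.

(** M is locally principal, and [approximation] glues its local generators at the primes of A above
    [m]. *)
Lemma exists_uniformizer : exists2 t, M t & subp M (sump (mulp t A) M2).
Proof.
have m0 : is_mod A (eq^~ (0 : L)).
  by split; [split=> // x y -> ->; rewrite subrr | move=> a x _ ->; rewrite mulr0].
have [z Mz z0] := extended_nonzero rR rA mm.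
have fM := fin_idx_mod rA mM (sMA Mz) Mz z0.
have [||x Xx hx] := @approximation L A unit M (eq^~ 0) (fun=> M) (fun=> A) rA mM m0
  (fun=> mM) (fun=> mod_ring rA) _ _ M iM fM.
- by move=> _ x c Mx Ac; apply: (modMr mM Ac Mx).
- move=> P mP; have [u mu h] := extended_generator rR rA sRA normal mm mP.
  exists (fun=> u) => [_|y /h]; first exact: extended_sub.
  apply: sump_mono => // _ [a Aa ->]; exists (fun=> a) => //.
  by rewrite (big_pred1 tt) ?subrr // => -[].
exists (x tt); first exact: Xx.
move=> y /hx; apply: sump_mono => // w [c Ac]; rewrite (big_pred1 tt) => [e|[] //].
by exists (c tt); [exact: Ac | rewrite -[w]subr0 -e subKr].
Qed.

Variable t : L.
Hypotheses (Mt : M t) (tM : subp M (sump (mulp t A) M2)).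

(** Write 1 as a sum of x w' with x in M and w' in M^-1, and x = t a + e with e in M^2. Then a w' (t
    w) lies in F and w' e lies in M. *)
Lemma uniformizer_div F w : is_mod A F -> A w -> ideal_mul M F (t * w) -> sump F (mulp w M) w.
Proof.
move=> mF Aw h; have mw := mod_mulp w mM; have mS := sump_mod mF mw.
have gS : addgrp (fun x => sump F (mulp w M) (x * w)).
  split; first by rewrite mul0r; exact: mS.1.1.
  by move=> x y hx hy; rewrite mulrBl; apply: mS.1.2.
rewrite -[X in sump _ _ X]mul1r.
apply: (ideal_mul_sub gS _ (extended_invertible rR rA sRA normal mm)) => x w' Mx hw'.
have [_ [a Aa ->] hM2] := tM Mx.
have -> : x * w' * w = a * (w' * (t * w)) + w * (w' * (x - t * a)) by ring.
apply: (agD mS.1 _ _).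
  apply: (sump_l mw.1); apply: (modM mF Aa _).
  have gT : addgrp (fun x => F (w' * x)).
    split; first by rewrite mulr0; exact: mF.1.1.
    by move=> y z hy hz; rewrite mulrBr; apply: mF.1.2.
  apply: (ideal_mul_sub gT _ h) => y z My Fz; rewrite mulrA; apply: (modM mF _ Fz).
  exact: hw'.
apply: (sump_r mF.1); exists (w' * (x - t * a)) => //.
have gT : addgrp (fun x => M (w' * x)).
  split; first by rewrite mulr0; exact: mM.1.1.
  by move=> y z hy hz; rewrite mulrBr; apply: mM.1.2.
apply: (ideal_mul_sub gT _ hM2) => y z My Mz; rewrite mulrA; apply: (modM mM _ Mz).
exact: hw'.
Qed.

Lemma uniformizer_div1 w : A w -> M2 (t * w) -> M w.
Proof.
move=> Aw /(uniformizer_div mM Aw); apply: (sump_sub mM.1) => // _ [y My ->].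
exact: modM mM Aw My.
Qed.

(** Division by [t] is done twice: the first time puts w in M, which places the error term wM of the
    second in M^2. *)
Lemma uniformizer_div2 w : A w -> M3 (t * w) -> M2 w.
Proof.
move=> Aw h; have Mw : M w by apply: uniformizer_div1 => //; apply: sM3.
have := uniformizer_div mM2 Aw h; apply: (sump_sub mM2.1) => // _ [y My ->].
exact: ideal_mulI.
Qed.

Lemma residue_index H s q : is_mod R H -> (forall x, m x -> H (x * s)) -> ~ H s ->
  index_is R m q -> index_is (adj R H s) H q.
Proof.
move=> mH ms Hs hq.
apply: (index_transfer (f := fun r => r * s) (maximal_ag mm) mH.1 hq).
- by move=> r Rr; exists r; rewrite ?subrr //; exact: mH.1.1.
- by move=> x y _ _ /ms; rewrite mulrBl.
- move=> x y Rx Ry; rewrite -mulrBl => h; apply: NNPP => mxy; apply: Hs.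
  by apply: (maximal_div mm mH ms _ h mxy); apply: ringB.
- by move=> y [r Rr h]; exists r.
Qed.

Let A0 := adj R M 1.

Lemma order_ring : is_subring A0.
Proof.
have mA0 : is_mod R A0 := mod_adj rR 1 mMR.
split; first by apply: adj_gen => //; exact: mM.1.1.
  exact: mA0.1.2.
move=> x y [r Rr]; rewrite mulr1 => hr hy.
have Ay : A y.
  case: hy => s Rs; rewrite mulr1 => /sMA; rewrite -{2}(subrK s y) => h.
  by apply: ringD => //; apply: sRA.
rewrite -(subrK r x) mulrDl; apply: (agD mA0.1); last exact: modM mA0 Rr hy.
by apply: adjS => //; apply: (modMr mM Ay hr).
Qed.

Lemma order_sub : subp R A0.
Proof. by move=> r Rr; exists r => //; rewrite mulr1 subrr; exact: mM.1.1. Qed.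

Lemma order_sup : subp A0 A.
Proof.
by apply: adj_sub (mod_sub sRA (mod_ring rA)) sMA _; exact: ring1.
Qed.

Definition twist V := sump (mulp t V) M2.

(** An R-module [V] is enough: tV lies in M, so M multiplies it into M^2, and tV + M^2 is stable
    under R + M. *)
Lemma twist_ideal V : is_mod R V -> subp V A -> is_ideal A0 (twist V).
Proof.
move=> mV sVA; have mtV := mod_mulp t mV; have mT := sump_mod mtV (mod_sub sRA mM2).
apply: mod_ideal.
  split=> [|a x]; first exact: mT.1.
  move=> [r Rr]; rewrite mulr1 => ha hx; rewrite -(subrK r a) mulrDl.
  apply: (agD mT.1); last exact: modM mT Rr hx.
  apply: (sump_r mtV.1); apply: ideal_mulI => //; move: hx; apply: (sump_sub mM.1) => //.
  by move=> _ [v /sVA Av ->]; apply: (modMr mM Av Mt).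
move=> x hx; apply: (adjS rR); move: hx; apply: (sump_sub mM.1) => //.
by move=> _ [v /sVA Av ->]; apply: (modMr mM Av Mt).
Qed.

Lemma twist_index V n : addgrp V -> subp V A -> index_is V M n -> index_is (twist V) M2 n.
Proof.
move=> gV sVA h; apply: (index_transfer (f := fun v => t * v) mM.1 mM2.1 h).
- by move=> v Vv; apply: (sump_l mM2.1); exists v.
- by move=> x y _ _ hxy; rewrite -mulrBr; apply: ideal_mulI.
- move=> x y Vx Vy; rewrite -mulrBr; apply: uniformizer_div1.
  by apply/sVA/gV.2.
- by move=> y [_ [v Vv ->] hy]; exists v.
Qed.

Lemma index_M2 n : index_is A M n -> index_is M M2 n.
Proof.
move=> h; apply: (index_transfer (f := fun v => t * v) mM.1 mM2.1 h).
- by move=> v Av; apply: (modMr mM Av Mt).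
- by move=> x y _ _ hxy; rewrite -mulrBr; apply: ideal_mulI.
- by move=> x y Ax Ay; rewrite -mulrBr; apply: uniformizer_div1; apply: ringB.
- by move=> y /tM[_ [v Av ->] hy]; exists v.
Qed.

Lemma index_M3 n : index_is A M n -> index_is M2 M3 n.
Proof.
move=> /index_M2 h; have gt := mulp_ag t mM.1.
apply: (index_transfer (f := fun v => t * v) mM2.1 mM3.1 h).
- by move=> v Mv; apply: ideal_mulI.
- by move=> x y _ _ hxy; rewrite -mulrBr; apply: ideal_mulI.
- by move=> x y /sMA Ax /sMA Ay; rewrite -mulrBr; apply: uniformizer_div2; apply: ringB.
have gS : addgrp (sump (mulp t M) M3) by apply: sump_ag => //; exact: mM3.1.
suff : subp M2 (sump (mulp t M) M3).
  by move=> h' y /h'[_ [v Mv ->] hv]; exists v.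
apply: ideal_mul_sub => // x y Mx My; have [_ [a Aa ->] hx] := tM Mx.
exists (t * (a * y)); first by exists (a * y) => //; exact: modM mM Aa My.
by rewrite mulrA -mulrBl mulrC; apply: ideal_mulI.
Qed.

(* With V = <1, a> and W = <1, b> modulo M, the colengths of t V + M^2 and t W + M^2 add up
   to more than that of their product t^2 VW + M^3 as soon as dim VW = 4. *)
Lemma not_independent q n a b : super_multiplicative A0 -> index_is R m q -> index_is A M n ->
  A a -> A b -> ~ A0 a -> ~ adj R A0 a b -> adj R (adj R A0 a) b (a * b).
Proof.
move=> sm hq hn Aa Ab ha hb; apply: NNPP => hab.
set V := adj R A0 a in hb hab; pose W := adj R A0 b; set Y3 := adj R V b in hab.
(* This is the product VW. Every step of the chain M, A0, V, Y3, Y4 has index q. *)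
pose Y4 := adj R Y3 (a * b).
have M1 : ~ M 1 by move=> M1; apply: ha; apply: adjS => //; rewrite -[a]mulr1; apply: (modM mM Aa M1).
have mA0 : is_mod R A0 := mod_adj rR 1 mMR.
have mV : is_mod R V := mod_adj rR a mA0; have mW : is_mod R W := mod_adj rR b mA0.
have mY3 : is_mod R Y3 := mod_adj rR b mV; have mY4 : is_mod R Y4 := mod_adj rR (a * b) mY3.
have mAR : is_mod R A := mod_sub sRA (mod_ring rA).
have sVA : subp V A by apply: (adj_sub mAR order_sup Aa).
have sWA : subp W A by apply: (adj_sub mAR order_sup Ab).
have sY3A : subp Y3 A by apply: (adj_sub mAR sVA Ab).
have sY4A : subp Y4 A by apply: (adj_sub mAR sY3A); exact: ringM.
have mM' s : A s -> forall x, m x -> M (x * s).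
  by move=> As x mx; apply: (modMr mM As); exact: extended_sub.
have sMA0 : subp M A0 by apply: adjS.
have sA0V : subp A0 V by apply: adjS.
have sA0W : subp A0 W by apply: adjS.
have sVY3 : subp V Y3 by apply: adjS.
have sY34 : subp Y3 Y4 by apply: adjS.
have iA0 : index_is A0 M q by apply: residue_index => //; apply: mM'; exact: ring1.
have iV0 : index_is V A0 q.
  by apply: residue_index => // x mx; apply/sMA0/mM'.
have iW0 : index_is W A0 q.
  by apply: residue_index => // [x mx|]; [apply/sMA0/mM' | move/sA0V].
have iY3 : index_is Y3 V q.
  by apply: residue_index => // x mx; apply/sA0V/sMA0/mM'.
have iY4 : index_is Y4 Y3 q.
  by apply: residue_index => // x mx; apply/sVY3/sA0V/sMA0/mM' => //; exact: ringM.
have iV : index_is V M (q * q) := index_trans mA0.1 mV.1 sA0V sMA0 mM.1 iV0 iA0.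
have iW : index_is W M (q * q) := index_trans mA0.1 mW.1 sA0W sMA0 mM.1 iW0 iA0.
have iY : index_is Y4 M (q * (q * (q * q))).
  have sVM : subp M V by move=> x /sMA0/sA0V.
  apply: (index_trans mY3.1 mY4.1 sY34 _ mM.1 iY4); first by move=> x /sVM/sVY3.
  exact: (index_trans mV.1 mY3.1 sVY3 sVM mM.1 iY3 iV).
have rA0 := order_ring.
have jV := twist_ideal mV sVA; have jW := twist_ideal mW sWA.
pose N := ideal_mul (twist V) (twist W).
have jN : is_ideal A0 N := ideal_mul_ideal rA0 jV jW.
have mN := ideal_mod jN; have mNR : is_mod R N := mod_sub order_sub mN.
have V1 : V 1 by apply: sA0V; exact: ring1.
have W1 : W 1 by apply: sA0W; exact: ring1.
have TV v : V v -> twist V (t * v) by move=> Vv; apply: (sump_l mM2.1); exists v.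
have TW v : W v -> twist W (t * v) by move=> Vv; apply: (sump_l mM2.1); exists v.
have TV2 x : M2 x -> twist V x by apply: sump_r; exact: mulp_ag mV.1.
have TW2 x : M2 x -> twist W x by apply: sump_r; exact: mulp_ag mW.1.
have TWM : subp (twist W) M.
  by apply: (sump_sub mM.1) => // _ [w /sWA Aw ->]; apply: (modMr mM Aw Mt).
have tV1 : twist V t by rewrite -[t]mulr1; apply: TV.
have tW1 : twist W t by rewrite -[t]mulr1; apply: TW.
have M3N : subp M3 N.
  apply: (ideal_mul_sub mN.1) => x y Mx My; have [_ [c Ac ->] hx] := tM Mx.
  have -> : x * y = t * (c * y) + (x - t * c) * y by ring.
  apply: (agD mN.1); apply: ideal_mulI => //; [|exact: TV2|exact: TW2].
  by apply: TW2; exact: modM mM2 Ac My.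
have NtY : forall y, Y4 y -> N (t * t * y).
  have mT : is_mod R (fun y => N (t * t * y)).
    split; first split; first by rewrite mulr0; exact: mN.1.1.
    - by move=> x y hx hy; rewrite mulrBr; apply: mN.1.2.
    - by move=> r x Rr hx; rewrite mulrCA; apply: (modM mNR Rr hx).
  apply: adj_sub => //; last first.
    have -> : t * t * (a * b) = (t * a) * (t * b) by ring.
    by apply: ideal_mulI; [apply: TV; exact: adj_gen mA0.1.1 | apply: TW; exact: adj_gen mA0.1.1].
  apply: adj_sub => //; last first.
    by rewrite -mulrA; apply: ideal_mulI => //; apply: TW; exact: adj_gen mA0.1.1.
  apply: adj_sub => //; last first.
    by rewrite -mulrA mulrC; apply: ideal_mulI => //; apply: TV; exact: adj_gen mA0.1.1.
  apply: adj_sub => //; last by rewrite mulr1; apply: ideal_mulI.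
  by move=> x Mx; rewrite -mulrA; apply: ideal_mulI => //; apply: TW2; apply: ideal_mulI.
have VW v w : V v -> W w -> Y4 (v * w).
  move=> Vv Ww; have sMY : subp M Y4 by move=> x /sMA0/sA0V/sVY3/sY34.
  have mT z : is_mod R (fun y => Y4 (y * z)).
    split; first split; first by rewrite mul0r; exact: mY4.1.1.
    - by move=> x y hx hy; rewrite mulrBl; apply: mY4.1.2.
    - by move=> r x Rr hx; rewrite -mulrA; apply: (modM mY4 Rr hx).
  have sA0Y : subp A0 Y4 by move=> x /sA0V/sVY3/sY34.
  have aY : Y4 a by apply/sY34/sVY3; exact: adj_gen mA0.1.1.
  have bY : Y4 b by apply/sY34; exact: adj_gen mV.1.1.
  have Y1 : Y4 1 by apply: sA0Y; exact: ring1.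
  have sWY : subp W Y4 by apply: adj_sub => //.
  have Aw := sWA _ Ww.
  move: v Vv; apply: (adj_sub (mT w)); last first.
    rewrite mulrC; move: w Ww Aw => w Ww _; move: w Ww; apply: (adj_sub (mT a)); last first.
      by rewrite mulrC; exact: adj_gen mY3.1.1.
    apply: (adj_sub (mT a)); last by rewrite mul1r.
    by move=> x Mx; apply/sMY/(modMr mM Aa Mx).
  apply: (adj_sub (mT w)); last by rewrite mul1r; apply: sWY.
  by move=> x Mx; apply/sMY/(modMr mM Aw Mx).
(* Multiplication by t^2 identifies VW / M with the product of the two ideals modulo M^3. *)
have iN : index_is N M3 (q * (q * (q * q))).
  apply: (index_transfer (f := fun y => t * t * y) mM.1 mM3.1 iY) => //.
  - move=> x y _ _ hxy; rewrite -mulrBr -mulrA; apply: ideal_mulI => //.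
    exact: ideal_mulI.
  - move=> x y /sY4A Ax /sY4A Ay; have Axy : A (x - y) by apply: ringB.
    rewrite -mulrBr -mulrA => h; apply: uniformizer_div1 => //; apply: uniformizer_div2 => //.
    by apply: ringM => //; apply: sMA.
  suff : subp N (sump (mulp (t * t) Y4) M3) by move=> h y /h[_ [v Yv ->] hv]; exists v.
  have gS : addgrp (sump (mulp (t * t) Y4) M3) by apply: sump_ag; [apply: mulp_ag mY4.1 | exact: mM3.1].
  apply: ideal_mul_sub => // x y [_ [v Vv ->] hx] Ty; have My := TWM _ Ty.
  case: Ty => _ [w Ww ->] hy; exists (t * t * (v * w)); first by exists (v * w) => //; apply: VW.
  have -> : x * y - t * t * (v * w) = (t * v) * (y - t * w) + y * (x - t * v) by ring.
  apply: (agD mM3.1); apply: ideal_mulI => //.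
  exact: modMr mM (sVA _ Vv) Mt.
have iA2 : index_is A0 M2 (q * n) := index_trans mM.1 mA0.1 sMA0 sM2 mM2.1 iA0 (index_M2 hn).
have sM2A0 : subp M2 A0 by move=> x /sM2/sMA0.
have iA3 : index_is A0 M3 (q * n * n) :=
  index_trans mM2.1 mA0.1 sM2A0 sM3 mM3.1 iA2 (index_M3 hn).
have [k [k' [hk hN ek]]] := index_factor mA0.1 mN.1 mM3.1 (ideal_sub jN) M3N iA3.
rewrite (index_unique mM3.1 hN iN) in ek.
have [p1 [p2 [hp1 hp2 le]]] := sm _ _ jV jW _ hk.
have e1 : (p1 * (q * q) = q * n)%N.
  apply: (index_unique mM2.1 _ iA2).
  exact: (index_trans (ideal_mod jV).1 mA0.1 (ideal_sub jV) TV2 mM2.1 hp1 (twist_index mV.1 sVA iV)).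
have e2 : (p2 * (q * q) = q * n)%N.
  apply: (index_unique mM2.1 _ iA2).
  exact: (index_trans (ideal_mod jW).1 mA0.1 (ideal_sub jW) TW2 mM2.1 hp2 (twist_index mW.1 sWA iW)).
have q1 : (1 < q)%N.
  case: q hq {iA0 iV0 iW0 iY3 iY4 iV iW iY iN iA2 iA3 ek e1 e2} => [|[|q]] // hq.
    by have := index_gt0 (ring0 rR) hq.
  by have [_ m1 _ _] := mm; case: m1; apply: (index1_sub (maximal_ag mm) (ring0 rR) hq); exact: ring1.
have n0 : (0 < n)%N := index_gt0 (ring0 rA) hn.
(* The two ideals have index n/q and their product has index n^2/q^3, so p1 p2 <= k would force q <=
   1. *)
have : (p1 * (q * q) * (p2 * (q * q)) <= k * (q * (q * (q * q))))%N.
  by rewrite mulnACA !mulnA -!mulnA; move: le; rewrite -(leq_pmul2r (_ : 0 < q * q * (q * q))%N) ?muln_gt0 ?(ltnW q1) // !mulnA.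
rewrite e1 e2 -ek mulnACA -!mulnA leq_pmul2l ?(ltnW q1) // -[X in (_ <= X)%N]mul1n.
by rewrite leq_pmul2r ?muln_gt0 ?n0 // leqNgt q1.
Qed.
End Violation.

(** * Algebras of dimension at least 4 in which 1, a, b, ab are always dependent *)

Section LinearAlgebra.
Variable L : fieldExtType rat.
Variables R A m M : L -> Prop.
Hypotheses (rR : is_subring R) (rA : is_subring A) (sRA : subp R A).
Hypothesis mm : maximal R m.
Hypotheses (iM : is_ideal A M) (nM : nonzero M) (smM : subp m M).
Hypothesis normal : forall x I, is_ideal A I -> nonzero I ->
  (forall y, I y -> I (x * y)) -> A x.
Implicit Types (x y z u v w a b n : L) (H : L -> Prop).

Let A0 := adj R M 1.
Let S2 a := adj R A0 a.
Let S3 a b := adj R (S2 a) b.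

Hypothesis dep : forall a b, A a -> A b -> ~ A0 a -> ~ S2 a b -> S3 a b (a * b).
Hypothesis rank4 : forall a b c, A a -> A b -> A c ->
  exists2 x, A x & ~ adj R (adj R (adj R M a) b) c x.

Let mM : is_mod A M := ideal_mod iM.
Let sMA : subp M A := ideal_sub iM.
Let mMR : is_mod R M := mod_sub sRA mM.
Let mA0 : is_mod R A0 := mod_adj rR 1 mMR.
Let mS2 a : is_mod R (S2 a) := mod_adj rR a mA0.
Let mS3 a b : is_mod R (S3 a b) := mod_adj rR b (mS2 a).
Let sMA0 : subp M A0. Proof. exact: adjS. Qed.
Let sA02 a : subp A0 (S2 a). Proof. exact: adjS. Qed.
Let s23 a b : subp (S2 a) (S3 a b). Proof. exact: adjS. Qed.
Let sM2 a : subp M (S2 a). Proof. by move=> x /sMA0/sA02. Qed.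
Let sM3 a b : subp M (S3 a b). Proof. by move=> x /sM2/s23. Qed.
Let RA0 r : R r -> A0 r.
Proof. by move=> Rr; exists r => //; rewrite mulr1 subrr; exact: mM.1.1. Qed.
Let mxM x y : m x -> A y -> M (x * y).
Proof. by move=> /smM Mx Ay; apply: (modMr mM Ay Mx). Qed.

Lemma exists_notin a b : A a -> A b -> exists2 x, A x & ~ S3 a b x.
Proof. by move=> Aa Ab; apply: rank4 => //; exact: ring1. Qed.

Lemma exists_notin2 a : A a -> exists2 x, A x & ~ S2 a x.
Proof. by move=> Aa; have [x Ax h] := exists_notin Aa Aa; exists x => // /s23. Qed.

Lemma mod_div H r s : is_mod R H -> subp M H -> A s -> R r -> H (r * s) -> ~ m r -> H s.
Proof.
by move=> mH sH As Rr h mr; apply: (maximal_div mm mH _ Rr h mr) => x mx; apply/sH/mxM.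
Qed.

(** Modulo <1, a>, [dep] makes every b an eigenvector of multiplication by a. Comparing b, b0 and b
    + b0 for independent b and b0 shows that all eigenvalues agree. *)
Lemma scalar_shift a : A a -> ~ A0 a -> exists2 l, R l & forall x, A x -> S2 a ((a - l) * x).
Proof.
move=> Aa ha; have [b0 Ab0 hb0] := exists_notin2 Aa.
have [l0 Rl0 hl0] := dep Aa Ab0 ha hb0.
have g2 := (mS2 a).1; have g3 := (mS3 a b0).1.
have claim b : A b -> ~ S3 a b0 b -> S2 a ((a - l0) * b).
  move=> Ab hb; have hb2 : ~ S2 a b by move/s23.
  have [lb Rlb hlb] := dep Aa Ab ha hb2.
  have As : A (b + b0) by apply: ringD.
  have hs : ~ S2 a (b + b0).
    move=> h; apply: hb; rewrite -(addrK b0 b); apply: g3.2; first exact: s23.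
    by apply: adj_gen => //; exact: g2.1.
  have [ls Rls hls] := dep Aa As ha hs.
  have h1 : S2 a ((ls - lb) * b + (ls - l0) * b0).
    have := g2.2 _ _ (agD g2 hlb hl0) hls; congr (S2 a); ring.
  have m1 : m (ls - lb).
    apply: NNPP => nm; apply: hb; apply: (mod_div (mS3 a b0) _ Ab _ _ nm) => //.
      exact: ringB.
    exists (- (ls - l0)); first by apply: ringN => //; exact: ringB.
    by rewrite mulNr opprK.
  have m2 : m (ls - l0).
    apply: NNPP => nm; apply: hb0; apply: (mod_div (mS2 a) _ Ab0 _ _ nm) => //.
      exact: ringB.
    have h2 : S2 a ((ls - lb) * b) by apply/sM2/mxM.
    by have := g2.2 _ _ h1 h2; congr (S2 a); ring.
  have m3 : m ((ls - l0) - (ls - lb)) by apply: (maximal_ag mm).2.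
  have h3 : S2 a (((ls - l0) - (ls - lb)) * b) by apply/sM2/mxM.
  by have := agD g2 hlb h3; congr (S2 a); ring.
exists l0 => // b Ab; case: (classic (S3 a b0 b)) => hb; last exact: claim.
(* An element of <1, a, b0> is the difference of two elements outside of it, b + b1 and b1. *)
have [b1 Ab1 hb1] := exists_notin Aa Ab0.
have c1 := claim b1 Ab1 hb1.
have c2 : S2 a ((a - l0) * (b + b1)).
  apply: claim; first exact: ringD.
  by move=> h; apply: hb1; rewrite -(addKr b b1) addrC; apply: g3.2.
by have := g2.2 _ _ c2 c1; congr (S2 a); ring.
Qed.

(** The line spanned by [n] over R/m is an ideal of A/M. *)
Definition special n := A n /\ forall x, A x -> adj R M n (n * x).

(** Multiplication by n = a - l maps A into <1, n>. A nonzero component at 1 would make n invertible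
    modulo M, so that A = <1, n>, which is too small. *)
Lemma special_shift a : A a -> ~ A0 a -> exists2 l, R l & special (a - l).
Proof.
move=> Aa ha; have [l Rl hl] := scalar_shift Aa ha; exists l => //.
set n := a - l in hl *; have An : A n by apply: ringB => //; exact: sRA.
have s2 : subp (S2 a) (S2 n).
  apply: (adj_sub (mS2 n)); first exact: sA02.
  rewrite -(subrK l a); apply: (agD (mS2 n).1); last exact/sA02/RA0.
  by apply: adj_gen => //; exact: mA0.1.1.
split=> // x Ax; have [s Rs [r Rr hM]] := s2 _ (hl x Ax).
case: (classic (m r)) => mr.
  exists s => //; rewrite -(subrK (r * 1) (_ - _)).
  by apply: (agD mM.1) => //; rewrite mulr1; apply: smM.
exfalso; have [_ _ _ /(_ r Rr mr) [c Rc hc]] := mm.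
have [z Az hz] := exists_notin2 An; apply: hz.
have Ac := sRA Rc; have As := sRA Rs.
pose y := c * (x - s); have Ay : A y by apply: ringM => //; apply: ringB.
have M1 : M (n * y - 1).
  have := mM.1.2 _ _ (modM mM Ac hM) (smM hc); congr M.
  by rewrite /y; ring.
have -> : z = n * (y * z) - (n * y - 1) * z by ring.
apply: (mS2 n).1.2; first by apply/s2/hl; exact: ringM.
by apply/sM2; apply: (modMr mM Az M1).
Qed.

(** The product lies on both lines, which meet only in zero modulo M. *)
Lemma special_orth n n' : special n -> special n' -> ~ adj R M n n' -> M (n * n').
Proof.
move=> [An hn] [An' hn'] h; have [r Rr h1] := hn n' An'; have [s Rs h2] := hn' n An.
have ms : m s.
  apply: NNPP => nms; apply: h; apply: (mod_div (mod_adj rR n mMR) _ An' Rs _ nms).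
    exact: adjS.
  by exists r => //; have := mM.1.2 _ _ h1 h2; congr M; ring.
have := agD mM.1 h2 (mxM ms An'); congr M; ring.
Qed.

(* If dim A/M >= 4 and 1, a, b, ab are always dependent mod [M], every element is a scalar plus
   a special one. Two independent special elements then generate an ideal [Q] whose image is
   annihilated by the same maximal ideal [P], so that Q/PQ has dimension 2, contradicting
   invertibility. *)
Lemma special_contradiction : False.
Proof.
have gM := mM.1.
have [a1 Aa1 ha1] := exists_notin2 (ring1 rA).
have ha1' : ~ A0 a1 by move/sA02.
have [l1 Rl1 sp1] := special_shift Aa1 ha1'.
move: sp1; set n1 := a1 - l1 => sp1; have An1 := sp1.1.
have h1 : ~ A0 n1.
  by move=> h; apply: ha1'; rewrite -(subrK l1 a1); apply: (agD mA0.1) => //; exact: RA0.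
have [a2 Aa2 ha2] := exists_notin2 An1.
have [l2 Rl2 sp2] : exists2 l, R l & special (a2 - l) by apply: special_shift => // /sA02.
move: sp2; set n2 := a2 - l2 => sp2; have An2 := sp2.1.
have h2 : ~ S2 n1 n2.
  move=> h; apply: ha2; rewrite -(subrK l2 a2); apply: (agD (mS2 n1).1) => //.
  exact/sA02/RA0.
have [a3 Aa3 ha3] := exists_notin An1 An2.
have [l3 Rl3 sp3] : exists2 l, R l & special (a3 - l).
  by apply: special_shift => // h; apply: ha3; apply/s23/sA02.
move: sp3; set n3 := a3 - l3 => sp3; have An3 := sp3.1.
have h3 : ~ S3 n1 n2 n3.
  move=> h; apply: ha3; rewrite -(subrK l3 a3); apply: (agD (mS3 n1 n2).1) => //.
  exact/s23/sA02/RA0.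
have n1S : S2 n1 n1 by apply: adj_gen => //; exact: mA0.1.1.
have n1S3 : S3 n1 n2 n1 by exact: s23.
have n2S3 : S3 n1 n2 n2 by apply: adj_gen => //; exact: (mS2 n1).1.1.
have notM1 : ~ M n1 by move=> /sMA0.
have ind12 : ~ adj R M n1 n2.
  by move=> h; apply: h2; move: h; apply: (adj_sub (mS2 n1)).
have [l Rl spl] : exists2 l, R l & special (n1 + n2 - l).
  apply: special_shift; first exact: ringD.
  move=> h; apply: h2; rewrite -(addKr n1 n2) addrC; apply: (mS2 n1).1.2 => //.
  exact: sA02.
(* n1, n2 and n1 + n2 - l all have product zero with n3 modulo M, so l n3 is in M. Hence n1 + n2 is
   itself special. *)
have ml : m l.
  apply: NNPP => nml.
  have m13 : M (n1 * n3).
    apply: special_orth => // h; apply: h3; move: h; apply: (adj_sub (mS3 n1 n2)) => //.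
  have m23 : M (n2 * n3).
    apply: special_orth => // h; apply: h3; move: h; apply: (adj_sub (mS3 n1 n2)) => //.
  have ml3 : M ((n1 + n2 - l) * n3).
    apply: special_orth => // h; apply: h3; move: h; apply: (adj_sub (mS3 n1 n2)) => //.
    apply: (mS3 n1 n2).1.2; first exact: (agD (mS3 n1 n2).1).
    exact/s23/sA02/RA0.
  apply: h3; apply: sM3; apply: (mod_div mMR _ An3 Rl _ nml) => //.
  by have := gM.2 _ _ (agD gM m13 m23) ml3; congr M; ring.
have sp12 x : A x -> exists2 r, R r & M ((n1 + n2) * x - r * (n1 + n2)).
  move=> Ax; have [r Rr h] := spl.2 x Ax; exists r => //.
  have := gM.2 _ _ (agD gM h (mxM ml Ax)) (mxM ml (sRA Rr)); congr M; ring.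
(* The annihilator of [n1] modulo M. Since A acts on the line of [n1] through scalars from R, A = R
   + P and [P] is maximal. *)
pose P x := A x /\ M (x * n1).
have mP : is_mod A P.
  split; first split.
  - by split; [exact: ring0 | rewrite mul0r; exact: gM.1].
  - by move=> x y [Ax hx] [Ay hy]; split; [exact: ringB | rewrite mulrBl; apply: gM.2].
  - by move=> x y Ax [Ay hy]; split; [exact: ringM | rewrite -mulrA; apply: (modM mM)].
have P1 : ~ P 1 by case=> _; rewrite mul1r.
have Pmax y : A y -> ~ P y -> exists2 c, A c & P (1 - c * y).
  move=> Ay Py; have [r Rr h] := sp1.2 y Ay.
  have mr : ~ m r.
    by move=> mr; apply: Py; split=> //; have := agD gM h (mxM mr An1); congr M; ring.
  have [_ _ _ /(_ r Rr mr) [c Rc hc]] := mm; have Ac := sRA Rc; exists c => //; split.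
    by apply: ringB; [exact: rA | exact: ring1 | exact: ringM].
  by have := gM.2 _ _ (mxM hc An1) (modM mM Ac h); congr M; ring.
(* [x] acts on n1, n2 and n1 + n2 by scalars. Independence of n1 and n2 makes the three scalars
   agree modulo [m], and the one on n1 is zero. *)
have P2 x : P x -> M (x * n2).
  move=> [Ax hx]; have [s Rs hs] := sp2.2 x Ax; have [r Rr hr] := sp12 x Ax.
  have m1 : m (s - r).
    apply: NNPP => nm; apply: ind12.
    apply: (mod_div (mod_adj rR n1 mMR) _ An2 _ _ nm); [exact: adjS | exact: ringB |].
    by exists r => //; have := gM.2 _ _ (gM.2 _ _ hr hs) hx; congr M; ring.
  have m2 : m r.
    apply: NNPP => nm; apply: notM1; apply: (mod_div mMR _ An1 Rr _ nm) => //.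
    by have := gM.2 _ _ (mxM m1 An2) (gM.2 _ _ (gM.2 _ _ hr hs) hx); congr M; ring.
  have h := mxM (agD (maximal_ag mm) m1 m2) An2.
  by have := agD gM hs h; congr M; ring.
pose Q := adj R (adj R M n1) n2.
have mQR : is_mod R Q := mod_adj rR n2 (mod_adj rR n1 mMR).
have sQA : subp Q A.
  have mAR := mod_sub sRA (mod_ring rA).
  by apply: adj_sub => //; apply: adj_sub.
have sMQ : subp M Q by move=> x Mx; do 2!apply: (adjS rR).
have nQ1 : Q n1 by apply: (adjS rR); apply: adj_gen => //; exact: gM.1.
have nQ2 : Q n2 by apply: adj_gen => //; exact: (mod_adj rR n1 mMR).1.1.
have Qmul (G : L -> Prop) x : is_mod R G -> subp M G -> A x -> G (x * n1) -> G (x * n2) ->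
    forall u, Q u -> G (x * u).
  move=> mG sG Ax G1 G2 u [r2 Rr2 [r1 Rr1 h]].
  have -> : x * u = x * (u - r2 * n2 - r1 * n1) + (r1 * (x * n1) + r2 * (x * n2)) by ring.
  apply: (agD mG.1); first by apply: sG; apply: (modM mM).
  by apply: (agD mG.1); apply: (modM mG).
have iQ : is_ideal A Q.
  apply: mod_ideal sQA; split; first exact: mQR.1.
  move=> x u Ax; apply: Qmul => //.
    have := sp1.2 x Ax; rewrite mulrC; move: (x * n1) => w.
    by move=> h; apply: (adjS rR).
  have := sp2.2 x Ax; rewrite mulrC; apply: adj_mono; exact: adjS.
have nzQ : nonzero Q by case: nM => z /sMQ Qz z0; exists z.
(* A local generator [u] at [P] gives Q inside uA + PQ. As PQ lies in M and A = R + P, this shrinks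
   to Ru + M, a line containing both n1 and n2. *)
have [u Qu [w hw Puw]] := invertible_generator iQ (invertible rA normal iQ nzQ) mP P1.
have Auw : A (u * w) by rewrite mulrC; apply: hw.
have dec := invertible_decomp rA iQ Qu hw (Pmax _ Auw Puw).
have PQ : subp (ideal_mul P Q) M.
  by apply: ideal_mul_sub => // x y Px Qy; apply: (Qmul _ x) => //; [exact: Px.1 | exact: Px.2 | exact: P2].
have sQu : subp Q (adj R M u).
  have mu := mod_adj rR u mMR.
  move=> x /dec; apply: (sump_sub mu.1) => [_ [y Ay ->]|y /PQ]; last exact: adjS.
  have [s Rs hs] := sp1.2 y Ay.
  have Pys : P (y - s).
    by split; [apply: ringB => //; exact: sRA | move: hs; congr M; ring].
  exists s => //; have : M ((y - s) * u) by apply: PQ; apply: ideal_mulI.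
  by congr M; ring.
have [al Ral hal] := sQu _ nQ1.
have mal : ~ m al.
  move=> mal; apply: notM1; have := agD gM hal (mxM mal (sQA _ Qu)); congr M; ring.
have un1 : adj R M n1 u.
  apply: (mod_div (mod_adj rR n1 mMR) _ (sQA _ Qu) Ral _ mal); first exact: adjS.
  exists 1; first exact: ring1.
  by have := agN gM hal; congr M; ring.
apply: ind12; apply: (adj_sub (mod_adj rR n1 mMR) _ un1 (sQu _ nQ2)).
exact: adjS.
Qed.
End LinearAlgebra.

(** * Three global generators from local rank at most 3 *)

Section Generation.
Variable L : fieldExtType rat.
Variable R : L -> Prop.
Hypothesis rR : is_subring R.
Implicit Types (I m : L -> Prop).

(** Greedy choice, padded with zeros if the span is reached early. *)
Lemma rank_le3_generators m I : maximal R m -> is_ideal R I -> rank_le3 R m I ->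
  exists s1 s2 s3, [/\ I s1, I s2, I s3 &
    subp I (adj R (adj R (adj R (ideal_mul m I) s1) s2) s3)].
Proof.
move=> mm iI rk; have mI := ideal_mod iI; have I0 := mI.1.1.
have mD := ideal_mul_mod (maximal_mod mm) mI.1.
have pick (G : L -> Prop) : subp I G \/ exists2 s, I s & ~ G s.
  case: (classic (subp I G)) => h; [by left | right; apply: NNPP => no; apply: h => s Is].
  by apply: NNPP => h; apply: no; exists s.
have sadj H s := @adjS L R rR H s.
case: (pick (ideal_mul m I)) => [h|[s1 I1 h1]].
  by exists 0, 0, 0; split=> // x /h; do 2![move/(sadj _ 0)]; apply: sadj.
case: (pick (adj R (ideal_mul m I) s1)) => [h|[s2 I2 h2]].
  by exists s1, 0, 0; split=> // x /h; move/(sadj _ 0); apply: sadj.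
case: (pick (adj R (adj R (ideal_mul m I) s1) s2)) => [h|[s3 I3 h3]].
  by exists s1, s2, 0; split=> // x /h; apply: sadj.
by exists s1, s2, s3; split=> // x Ix; apply: rk.
Qed.

(** As in [exists_factorization], there are two rounds: three elements modulo zR, then the last two
    again modulo aR with a kept, where the error aI is absorbed by aR. *)
Lemma gen_by_3_of_rank_le3 I : is_ideal R I -> nonzero I ->
  (forall m, maximal R m -> rank_le3 R m I) -> gen_by_3 R I.
Proof.
move=> iI [z Iz z0] rk; have mI := ideal_mod iI; have Rz := ideal_sub iI Iz.
have mR := mod_ring rR.
have m0 : is_mod R (eq^~ (0 : L)).
  by split; [split=> // x y -> ->; rewrite subrr | move=> a x _ ->; rewrite mulr0].
have IR x c : I x -> R c -> I (x * c) by move=> Ix Rc; apply: (modMr mI Rc Ix).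
have iz : is_ideal R (mulp z R).
  by apply: mod_ideal; [exact: mod_mulp | exact: mulp_sub mR Rz].
have [m mm|x Xx hx] := @approximation L R 'I_3 I (eq^~ 0) (fun=> I) (fun=> R) rR mI m0
  (fun=> mI) (fun=> mR) (fun=> IR) _ _ iz (fin_idx_principal rR Rz z0).
  have mmI := ideal_mul_mod (maximal_mod mm) mI.1.
  have [s1 [s2 [s3 [I1 I2 I3 h]]]] := rank_le3_generators mm iI (rk m mm).
  pose s := [:: s1; s2; s3]; exists (fun i : 'I_3 => s`_i).
    by case=> -[|[|[|]]].
  have mT := comb_mod m0 (fun _ : 'I_3 => mR) (fun i : 'I_3 => s`_i).
  have mS := sump_mod mT mmI.
  have sI (i : 'I_3) : sump (comb (eq^~ 0) (fun=> R) (fun i : 'I_3 => s`_i)) (ideal_mul m I) s`_i.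
    apply: (sump_l mmI.1); exists (fun j => (j == i)%:R); first by move=> j; exact: ring_nat.
    rewrite (bigD1 i) //= eqxx mulr1 big1 ?addr0 ?subrr // => j /negPf ->.
    by rewrite mulr0.
  move=> y /h; apply: (adj_sub mS); last exact: (sI (@Ordinal 3 2 isT)).
  apply: (adj_sub mS); last exact: (sI (@Ordinal 3 1 isT)).
  by apply: (adj_sub mS); [exact: sump_r mT.1 | exact: (sI (@Ordinal 3 0 isT))].
have {hx Xx} [a [b [c [Ia Ib Ic a0 cov]]]] : exists a b c, [/\ I a, I b, I c, a != 0 &
    forall S, is_mod R S -> S a -> S b -> S c -> subp (ideal_mul (mulp z R) I) S -> subp I S].
  pose i0 := @Ordinal 3 0 isT; pose i1 := @Ordinal 3 1 isT; pose i2 := @Ordinal 3 2 isT.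
  have h S : is_mod R S -> S (x i0) -> S (x i1) -> S (x i2) ->
      subp (ideal_mul (mulp z R) I) S -> subp I S.
    move=> mS S0 S1 S2 sS y /hx; apply: (sump_sub mS.1) sS _ => w [d Rd e].
    rewrite -[w]subr0 -e subKr; apply: ag_sum => [|i _]; first exact: mS.1.
    apply: (modMr mS (Rd i)); case: i => -[|[|[|//]]] ilt.
    - by rewrite (_ : Ordinal ilt = i0) //; apply: val_inj.
    - by rewrite (_ : Ordinal ilt = i1) //; apply: val_inj.
    - by rewrite (_ : Ordinal ilt = i2) //; apply: val_inj.
  case: (eqVneq (x i0) 0) => [x0|x0].
    exists (z * z), (x i1), (x i2); split; [exact: (modM mI Rz Iz)|exact: Xx|exact: Xx|exact: mulf_neq0|].
    by move=> S mS _ S1 S2; apply: h => //; rewrite x0; exact: mS.1.1.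
  by exists (x i0), (x i1), (x i2); split=> //; exact: Xx.
have Ra := ideal_sub iI Ia; have maR := mod_mulp a mR.
have ia : is_ideal R (mulp a R) by apply: mod_ideal => //; exact: mulp_sub mR Ra.
have [m mm|y Xy hy] := @approximation L R bool I (mulp a R) (fun=> I) (fun=> R) rR mI maR
  (fun=> mI) (fun=> mR) (fun=> IR) _ _ ia (fin_idx_principal rR Ra a0).
  have mmI := ideal_mul_mod (maximal_mod mm) mI.1.
  have mT u : is_mod R (comb (mulp a R) (fun=> R) (u : bool -> L)).
    exact: (comb_mod maR (fun=> mR)).
  have gen u (i : bool) : comb (mulp a R) (fun=> R) u (u i).
    exists (fun j => (j == i)%:R); first by move=> j; exact: ring_nat.
    rewrite (bigD1 i) //= eqxx mulr1 big1 ?addr0 ?subrr; first exact: maR.1.1.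
    by move=> j /negPf ->; rewrite mulr0.
  case: (classic (m z)) => mz.
    pose u i := if i then b else c; exists u; first by case.
    apply: cov; first exact: sump_mod.
    - apply: (sump_l mmI.1); exists (fun=> 0); first by move=> _; exact: ring0.
      rewrite big1 ?subr0; last by move=> *; rewrite mulr0.
      by exists 1; [exact: ring1 | rewrite mulr1].
    - exact: (sump_l mmI.1 (gen u true)).
    - exact: (sump_l mmI.1 (gen u false)).
    - move=> w hw; apply: (sump_r (mT u).1); move: w hw; apply: ideal_mulS => //.
      exact: mulp_sub (maximal_mod mm) mz.
  (* Here z is a unit modulo [m] and lies in [I], so it generates I modulo mI by itself. *)
  pose u (i : bool) := z; exists u => // w Iw.
  have [_ _ _ /(_ z Rz mz) [d Rd hd]] := mm.
  have -> : w = (d * w) * z + (1 - d * z) * w by ring.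
  apply: (agD (sump_mod (mT u) mmI).1).
    apply: (sump_l mmI.1); apply: (modM (mT u)); last exact: (gen u true).
    exact: ringM (ideal_sub iI Iw).
  by apply: (sump_r (mT u).1); apply: ideal_mulI.
exists a, (y true), (y false); split=> //; [exact: ideal_sub iI _ (Xy _)|exact: ideal_sub iI _ (Xy _)|].
have span3 w : comb (mulp a R) (fun=> R) y w -> exists r1 r2 r3,
    [/\ R r1, R r2, R r3 & w = r1 * a + r2 * y true + r3 * y false].
  move=> [d Rd [r Rr e]]; exists r, (d true), (d false); split=> //.
  by rewrite -(subrK (\sum_i y i * d i) w) e big_bool /=; ring.
move=> w; split=> [/hy h|[r1 [r2 [r3 [R1 R2 R3 ->]]]]].
  apply: span3; have mT := comb_mod maR (fun _ : bool => mR) y.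
  move: h; apply: (sump_sub mT.1) => // v hv.
  exists (fun=> 0); first by move=> _; exact: ring0.
  rewrite big1 ?subr0; last by move=> *; rewrite mulr0.
  by move: v hv; apply: ideal_mul_sub_modl maR _; exact: ideal_sub.
apply: (agD mI.1); last exact: modM mI R3 (Xy _).
by apply: (agD mI.1); [exact: modM mI R1 Ia | exact: modM mI R2 (Xy _)].
Qed.
End Generation.

(** * The two implications *)

Section Main.
Variable L : fieldExtType rat.
Variable R : L -> Prop.
Hypothesis rR : is_subring R.
Implicit Types (I m : L -> Prop).

(** Four elements of an R'-ideal have a common denominator d in [R]. Their multiples by d generate
    an ideal of [R] with three generators, and dividing these by d leads back into the R'-ideal. *)
Lemma gen_by_3_super_multiplicative R' : (forall I, is_ideal R I -> gen_by_3 R I) ->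
  is_subring R' -> subp R R' -> (forall x, R' x -> normalization R x) -> super_multiplicative R'.
Proof.
move=> gen rR' sRR' nrm; apply: super_multiplicative_rank_le3 => // m N mm iN.
have mN := ideal_mod iN; have mNR := mod_sub sRR' mN.
have m0 : is_mod R (eq^~ (0 : L)).
  by split; [split=> // x y -> ->; rewrite subrr | move=> a x _ ->; rewrite mulr0].
have m0' : is_mod R' (eq^~ (0 : L)).
  by split; [split=> // x y -> ->; rewrite subrr | move=> a x _ ->; rewrite mulr0].
apply: rank_le3_span => // s1 s2 s3 s4 N1 N2 N3 N4; pose s := [:: s1; s2; s3; s4].
have sN x : x \in s -> N x.
  by rewrite !inE => /or4P[] /eqP ->.
have [d [Rd d0 hd]] : exists d, [/\ R d, d != 0 & forall x, x \in s -> R (d * x)].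
  have : forall x, x \in s -> N x by [].
  elim: s {sN} => [|x t IH] ht; first by exists 1; split; [exact: ring1 | exact: oner_neq0 |].
  have [y yt|d [Rd d0 hd]] := IH; first by apply: ht; rewrite inE yt orbT.
  have [[u [v [Ru Rv v0 e]]] _] := nrm x (ideal_sub iN (ht x (mem_head _ _))).
  exists (d * v); split; [exact: ringM | exact: mulf_neq0 |].
  move=> y; rewrite inE => /predU1P[->|/hd h].
    by have -> : d * v * x = d * u; [rewrite e; field | apply: ringM].
  by rewrite mulrAC; apply: ringM.
pose I := seq_span R (eq^~ 0) [seq d * x | x <- s].
have mI : is_mod R I by apply: seq_span_mod.
have iI : is_ideal R I.
  apply: mod_ideal mI _; apply: seq_span_least; [exact: mod_ring | by move=> _ ->; exact: ring0 |].
  by move=> _ /mapP[x /hd h ->].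
have [a [b [c [Ra Rb Rc hI]]]] := gen I iI.
have R0 := ring0 rR; have R1 := ring1 rR.
have Ia : I a by apply/hI; exists 1, 0, 0; split=> //; ring.
have Ib : I b by apply/hI; exists 0, 1, 0; split=> //; ring.
have Ic : I c by apply/hI; exists 0, 0, 1; split=> //; ring.
have IN x : I x -> N (x / d).
  have mT : is_mod R (fun x => N (x / d)).
    split; first split; first by rewrite mul0r; exact: mN.1.1.
    - by move=> u v hu hv; rewrite mulrBl; apply: mN.1.2.
    - by move=> r u Rr hu; rewrite -mulrA; apply: (modM mNR).
  move: x; apply: (seq_span_least mT); first by move=> _ ->; rewrite mul0r; exact: mN.1.1.
  by move=> _ /mapP[x /sN Nx ->]; rewrite mulrC mulKf.
exists [:: a / d; b / d; c / d]; split=> //.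
  by move=> x; rewrite !inE => /or3P[] /eqP ->; apply: IN.
move=> x xs; have : I (d * x) by apply: (seq_span_mem rR m0); apply: map_f.
case/hI=> r1 [r2 [r3 [R1' R2' R3' e]]].
have -> : x = r1 * (a / d) + r2 * (b / d) + r3 * (c / d).
  by apply: (mulfI d0); rewrite e; field.
have mS := seq_span_mod rR' [:: a / d; b / d; c / d] m0'.
have mem y : y \in [:: a / d; b / d; c / d] -> seq_span R' (eq^~ 0) [:: a / d; b / d; c / d] y.
  exact: seq_span_mem.
apply: (agD mS.1); [apply: (agD mS.1)|].
- by apply: (modM mS); [apply: sRR' | apply: mem; rewrite !inE eqxx].
- by apply: (modM mS); [apply: sRR' | apply: mem; rewrite !inE eqxx orbT].
- by apply: (modM mS); [apply: sRR' | apply: mem; rewrite !inE eqxx !orbT].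
Qed.

Lemma adj_index_le m H M s q k : maximal R m -> is_mod R H -> is_mod R M -> subp M H ->
  (forall x, m x -> M (x * s)) -> index_is R m q -> (0 < q)%N -> index_is H M k ->
  exists2 k', index_is (adj R H s) M k' & (k' <= k * q)%N.
Proof.
move=> mm mH mM sMH ms hq q0 hk; case: (classic (H s)) => Hs.
  exists k; last by rewrite leq_pmulr.
  apply: (index_ext mM.1 mM.1 hk) => // x; split; first exact: adjS.
  by apply: (adj_sub mH).
exists (k * q)%N => //; rewrite mulnC.
apply: (index_trans mH.1 (mod_adj rR s mH).1 (@adjS _ _ rR H s) sMH mM.1 _ hk).
by apply: (residue_index rR mm) => // x /ms; apply: sMH.
Qed.

Lemma super_multiplicative_rank m I :
  (forall R' : L -> Prop, is_subring R' -> subp R R' ->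
     (forall x, R' x -> normalization R x) -> super_multiplicative R') ->
  maximal R m -> is_ideal R I -> nonzero I -> rank_le3 R m I.
Proof.
move=> sm mm iI nI s1 s2 s3 s4 I1 I2 I3 I4 h1 h2 h3; apply: NNPP => h4.
have mI := ideal_mod iI; have gm := maximal_ag mm.
pose A := stable R; have rA : is_subring A := stable_ring rR.
have sRA : subp R A := stable_sub rR.
have normal := stable_closed rR.
have [d d0 dA] := stable_conductor rR.
pose M := extended A m; have mM : is_mod A M := extended_mod rA mm.
have mMR := mod_sub sRA mM; have iM : is_ideal A M := extended_ideal rA sRA mm.
have nM : nonzero M := extended_nonzero rR rA mm.
have fm : fin_idx R m by case: mm.
have [q hq] := fin_index (ring0 rR) gm fm.
have q1 : (1 < q)%N.
  case: q hq => [|[|q]] // hq; first by have := index_gt0 (ring0 rR) hq.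
  by have [_ m1 _ _] := mm; case: m1; apply: (index1_sub gm (ring0 rR) hq); exact: ring1.
have fM : fin_idx A M.
  have [z Mz z0] := nM; exact: (fin_idx_mod rA mM (ideal_sub iM Mz) Mz z0).
have [n hn] := fin_index (ring0 rA) mM.1 fM.
set D := ideal_mul m I in h1 h2 h3 h4.
have mD : is_mod R D := ideal_mul_mod (maximal_mod mm) mI.1.
have sDI : subp D I := ideal_mul_sub_mod mI (ideal_sub (maximal_ideal mm)).
have fD : fin_idx I D.
  have [z mz z0] := maximal_nonzero rR mm; have [y Iy y0] := nI.
  apply: (fin_idx_sub (ideal_sub iI)); apply: (fin_idx_mod rR mD (x := z * y)).
  - by apply: ringM => //; [exact: ideal_sub (maximal_ideal mm) _ mz | exact: ideal_sub iI _ Iy].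
  - exact: ideal_mulI.
  - exact: mulf_neq0.
have [k hk] := fin_index mI.1.1 mD.1 fD.
have kn : (k <= n)%N := index_mul_le rR rA sRA normal mm d0 dA iI nI hn hk.
have mulD s : I s -> forall x, m x -> D (x * s) by move=> Is x mx; apply: ideal_mulI.
pose D1 := adj R D s1; pose D2 := adj R D1 s2; pose D3 := adj R D2 s3; pose D4 := adj R D3 s4.
have mD1 : is_mod R D1 := mod_adj rR _ mD; have mD2 : is_mod R D2 := mod_adj rR _ mD1.
have mD3 : is_mod R D3 := mod_adj rR _ mD2; have mD4 : is_mod R D4 := mod_adj rR _ mD3.
have e1 : subp D D1 by apply: adjS.
have e2 : subp D1 D2 by apply: adjS.
have e3 : subp D2 D3 by apply: adjS.
have e4 : subp D3 D4 by apply: adjS.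
have i1 : index_is D1 D q by apply: (residue_index rR mm mD (mulD _ I1)).
have i2 : index_is D2 D (q * q).
  apply: (index_trans mD1.1 mD2.1 e2 e1 mD.1 _ i1).
  by apply: (residue_index rR mm mD1) => // x mx; apply/e1/mulD.
have i3 : index_is D3 D (q * (q * q)).
  apply: (index_trans mD2.1 mD3.1 e3 _ mD.1 _ i2); first by move=> x /e1/e2.
  by apply: (residue_index rR mm mD2) => // x mx; apply/e2/e1/mulD.
have i4 : index_is D4 D (q * (q * (q * q))).
  apply: (index_trans mD3.1 mD4.1 e4 _ mD.1 _ i3); first by move=> x /e1/e2/e3.
  by apply: (residue_index rR mm mD3) => // x mx; apply/e3/e2/e1/mulD.
have sD4 : subp D4 I by do 4!apply: (adj_sub mI) => //.
(* Four independent elements of I/mI give q^4 <= [I : mI] <= [A : M]. *)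
have q4 : (q * (q * (q * q)) <= n)%N by apply: leq_trans kn; exact: (index_sub_le mD.1 hk i4 sD4).
have mxM x y : m x -> A y -> M (x * y) by exact: ideal_mulI.
have q0 := ltnW q1.
(* Three elements span at most q^3 classes modulo M, fewer than [A : M]. *)
have rank4 a b c : A a -> A b -> A c -> exists2 x, A x & ~ adj R (adj R (adj R M a) b) c x.
  move=> Aa Ab Ac; apply: NNPP => no.
  have all : subp A (adj R (adj R (adj R M a) b) c).
    by move=> x Ax; apply: NNPP => h; apply: no; exists x.
  have iMM : index_is M M 1.
    have [j hj] := fin_index mM.1.1 mM.1 (fin_idx_sub (ideal_sub iM) fM).
    suff -> : 1%N = j by [].
    by apply/eqP; rewrite eqn_leq (index_gt0 mM.1.1 hj) (index_full mM.1 (fun _ h => h) hj).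
  have N1 := mod_adj rR a mMR; have N2 := mod_adj rR b N1.
  have f1 : subp M (adj R M a) by apply: adjS.
  have f2 : subp M (adj R (adj R M a) b) by move=> x /f1; apply: adjS.
  have [k1 g1 l1] := adj_index_le mm mMR mMR (fun _ h => h) (fun x mx => mxM _ _ mx Aa) hq q0 iMM.
  have [k2 g2 l2] := adj_index_le mm N1 mMR f1 (fun x mx => mxM _ _ mx Ab) hq q0 g1.
  have [k3 g3 l3] := adj_index_le mm N2 mMR f2 (fun x mx => mxM _ _ mx Ac) hq q0 g2.
  have nk3 := index_sub_le mM.1 g3 hn all.
  have : (q * (q * (q * q)) <= q * (q * q))%N.
    apply: (leq_trans q4 (leq_trans nk3 (leq_trans l3 _))).
    rewrite mulnC leq_mul2l; apply/orP; right.
    apply: (leq_trans l2); rewrite leq_mul2r; apply/orP; right.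
    by rewrite (leq_trans l1) // mul1n.
  by rewrite leqNgt -{1}[(q * (q * q))%N]mul1n ltn_pmul2r ?q1 // !muln_gt0 q0.
have [t Mt tM] := exists_uniformizer rR rA sRA normal mm.
apply: (special_contradiction rR rA sRA mm iM nM (extended_sub rA (m := m)) normal _ rank4).
move=> a b Aa Ab; apply: (not_independent rR rA sRA normal mm Mt tM _ hq hn Aa Ab).
(* The intermediate ring on which (ii) is tested is R + M. *)
apply: sm; first exact: order_ring.
  exact: order_sub.
by move=> x /(order_sup rA sRA mm) /(stable_normalization rR).
Qed.
End Main.

Theorem theorem1p1 (L : fieldExtType rat) (R : L -> Prop) :
  is_subring R ->
  ((forall I, is_ideal R I -> gen_by_3 R I) <->
   (forall R' : L -> Prop, is_subring R' ->
      (forall x, R x -> R' x) -> (forall x, R' x -> normalization R x) ->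
      super_multiplicative R')).
Proof.
move=> rR; split=> [gen R' rR' sRR' nrm|sm I iI].
  exact: gen_by_3_super_multiplicative nrm.
case: (classic (nonzero I)) => nI.
  by apply: gen_by_3_of_rank_le3 => // m mm; apply: super_multiplicative_rank.
exists 0, 0, 0; split; try exact: ring0.
move=> x; split=> [Ix|[r1 [r2 [r3 [_ _ _ ->]]]]].
  exists 0, 0, 0; split; try exact: ring0.
  rewrite !mulr0 !addr0; apply/eqP; case: eqVneq => // x0; case: nI; by exists x.
by rewrite !mulr0 !addr0; case: iI.
Qed.
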